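(* Under the standing setting: (a) If $f_0=0$ and $f_\infty\in(0,\infty)$, then there exist $\lambda_*\in(0,\infty)$ and $m_*\in(0,\infty]$ such that for every $\lambda\in(\lambda_*,\infty)$ problem (P$_\lambda$) has a positive solution $u(\lambda)$ with $\|u(\lambda)\|_\infty\in(0,m_* )$, these solutions can be chosen so that $\lim_{\lambda\to\infty}\|u(\lambda)\|_\infty=0$, and, if $m_*\in(0,\infty)$, problem (P$_{\lambda_*}$) has a positive solution. (b) If $f_0\in(0,\infty)$ and $f_\infty=0$, then there exist $\lambda_*\in(0,\infty)$ and $m_*\in[0,\infty)$ such that for every $\lambda\in(\lambda_*,\infty)$ problem (P$_\lambda$) has a positive solution $u(\lambda)$ with $\|u(\lambda)\|_\infty\in(m_*,\infty)$, these solutions can be chosen so that $\lim_{\lambda\to\infty}\|u(\lambda)\|_\infty=\infty$, and, if $m_*\in(0,\infty)$, problem (P$_{\lambda_*}$) has a positive solution.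
   Context: Standing setting. $\varphi:\mathbb{R}\to\mathbb{R}$ is an odd, increasing homeomorphism satisfying condition (A): there exist increasing homeomorphisms $\psi_1,\psi_2:[0,\infty)\to[0,\infty)$ such that $\varphi(x)\psi_1(y)\le \varphi(xy)\le \varphi(x)\psi_2(y)$ for all $x,y\ge 0$. Let $c,d\in C([0,1],(0,\infty))$, and $\|\cdot\|_\infty$ the maximum norm on $C[0,1]$. Let $f\in C([0,\infty),[0,\infty))$ with $f(s)>0$ for $s>0$, and write $f_0=\lim_{s\to0^+}f(s)/\varphi(s)$, $f_\infty=\lim_{s\to\infty}f(s)/\varphi(s)$ (assumed to exist in $[0,\infty]$ whenever referred to). Let $h\in C((0,1),[0,\infty))$, $h\not\equiv 0$, with $\int_0^{1/2}\psi_1^{-1}\big(\int_s^{1/2}h(\tau)d\tau\big)ds+\int_{1/2}^1\psi_1^{-1}\big(\int_{1/2}^s h(\tau)d\tau\big)ds<\infty$. Notation attached to $h$: $\alpha_h=\sup\{x\in(0,1): h=0 \text{ on }(0,x)\}$ ($0$ if empty); $\beta_h=\inf\{x\in(0,1): h=0\text{ on }(x,1)\}$ ($1$ if empty); $\bar\alpha_h=\sup\{x\in(\alpha_h,1]: h>0 \text{ on }(\alpha_h,x)\}$; $\bar\beta_h=\inf\{x\in[0,\beta_h): h>0\text{ on }(x,\beta_h)\}$; $\gamma_h^1=(3\alpha_h+\bar\alpha_h)/4$, $\gamma_h^2=(\bar\beta_h+3\beta_h)/4$. It is assumed that $0\le\alpha_h<\gamma_h^1<\gamma_h^2<\beta_h\le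 1$. For $\lambda\ge0$, problem (P$_\lambda$) is: $(d(t)\varphi(c(t)u'(t)))'+\lambda h(t)f(u(t))=0$ for $t\in(0,1)$, $u(0)=u(1)=0$. A solution is $u\in C[0,1]\cap C^1(0,1)$ such that $t\mapsto d(t)\varphi(c(t)u'(t))$ is continuously differentiable on $(0,1)$ and the equation and boundary conditions hold; it is positive if $u(t)>0$ for all $t\in(0,1)$. *)

(* Defs.v *)
From Stdlib Require Import Reals Lra Classical ClassicalEpsilon.
Open Scope R_scope.

Definition cont_on (D : R -> Prop) (f : R -> R) : Prop :=
  forall x, D x -> forall eps, 0 < eps ->
    exists del, 0 < del /\ forall y, D y -> Rabs (y - x) < del -> Rabs (f y - f x) < eps.

Definition nonneg (x : R) : Prop := 0 <= x.
Definition I01 (x : R) : Prop := 0 <= x <= 1.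
Definition O01 (x : R) : Prop := 0 < x < 1.

Definition odd_incr_homeo (phi : R -> R) : Prop :=
  (forall x, phi (- x) = - phi x) /\
  (forall x y, x < y -> phi x < phi y) /\
  continuity phi /\
  (forall y, exists x, phi x = y).

(* psi : increasing homeomorphism of [0,oo) onto [0,oo) (values outside irrelevant) *)
Definition incr_homeo_pos (psi : R -> R) : Prop :=
  (forall x y, 0 <= x -> x < y -> psi x < psi y) /\
  cont_on nonneg psi /\
  (forall x, 0 <= x -> 0 <= psi x) /\
  (forall y, 0 <= y -> exists x, 0 <= x /\ psi x = y).

Definition inv_pos (psi : R -> R) (y : R) : R :=
  epsilon (inhabits 0) (fun x => 0 <= x /\ psi x = y).

Definition RInt (f : R -> R) (a b : R) : R :=
  match excluded_middle_informative (inhabited (Riemann_integrable f a b)) with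
  | left H => RiemannInt (epsilon H (fun _ => True))
  | right _ => 0
  end.

(* the integrability hypothesis on h (finite improper integrals of
   nonnegative integrands) *)
Definition h_integrability (psi1 h : R -> R) : Prop :=
  exists B,
    (forall e, 0 < e < 1/2 ->
       RInt (fun s => inv_pos psi1 (RInt h s (1/2))) e (1/2) <= B) /\
    (forall e, 0 < e < 1/2 ->
       RInt (fun s => inv_pos psi1 (RInt h (1/2) s)) (1/2) (1 - e) <= B).

Definition alpha_set (h : R -> R) (x : R) : Prop :=
  0 < x < 1 /\ forall t, 0 < t < x -> h t = 0.
Definition is_alpha (h : R -> R) (a : R) : Prop :=
  ((exists x, alpha_set h x) /\ is_lub (alpha_set h) a) \/
  ((~ exists x, alpha_set h x) /\ a = 0).

Definition beta_set (h : R -> R) (x : R) : Prop :=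
  0 < x < 1 /\ forall t, x < t < 1 -> h t = 0.
Definition is_glb (E : R -> Prop) (m : R) : Prop :=
  (forall x, E x -> m <= x) /\ (forall b, (forall x, E x -> b <= x) -> b <= m).
Definition is_beta (h : R -> R) (b : R) : Prop :=
  ((exists x, beta_set h x) /\ is_glb (beta_set h) b) \/
  ((~ exists x, beta_set h x) /\ b = 1).

Definition abar_set (h : R -> R) (a x : R) : Prop :=
  a < x <= 1 /\ forall t, a < t < x -> 0 < h t.
Definition bbar_set (h : R -> R) (b x : R) : Prop :=
  0 <= x < b /\ forall t, x < t < b -> 0 < h t.

Definition gamma_hyp (h : R -> R) : Prop :=
  exists a b ab bb,
    is_alpha h a /\ is_beta h b /\
    is_lub (abar_set h a) ab /\ is_glb (bbar_set h b) bb /\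
    0 <= a /\ a < (3 * a + ab) / 4 /\ (3 * a + ab) / 4 < (bb + 3 * b) / 4 /\
    (bb + 3 * b) / 4 < b /\ b <= 1.

Definition supnorm (u : R -> R) : R :=
  epsilon (inhabits 0)
    (fun m => is_lub (fun y => exists t, 0 <= t <= 1 /\ y = Rabs (u t)) m).

Definition is_solution (phi c d h f : R -> R) (lam : R) (u : R -> R) : Prop :=
  cont_on I01 u /\ u 0 = 0 /\ u 1 = 0 /\
  exists u' w' : R -> R,
    (forall t, 0 < t < 1 -> derivable_pt_lim u t (u' t)) /\
    cont_on O01 u' /\
    (forall t, 0 < t < 1 ->
       derivable_pt_lim (fun s => d s * phi (c s * u' s)) t (w' t)) /\
    cont_on O01 w' /\
    (forall t, 0 < t < 1 -> w' t + lam * h t * f (u t) = 0).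

Definition is_pos_solution (phi c d h f : R -> R) (lam : R) (u : R -> R) : Prop :=
  is_solution phi c d h f lam u /\ forall t, 0 < t < 1 -> 0 < u t.

Definition lim_0plus (g : R -> R) (L : R) : Prop :=
  forall eps, 0 < eps -> exists del, 0 < del /\
    forall s, 0 < s < del -> Rabs (g s - L) < eps.
Definition lim_infty (g : R -> R) (L : R) : Prop :=
  forall eps, 0 < eps -> exists M, forall s, M < s -> Rabs (g s - L) < eps.
Definition diverges_infty (g : R -> R) : Prop :=
  forall K, exists M, forall s, M < s -> K < g s.

(* extended reals (0,oo]: None stands for +oo *)
Definition lt_ext (x : R) (m : option R) : Prop :=
  match m with Some m => x < m | None => True end.
Definition pos_ext (m : option R) : Prop := lt_ext 0 m.

Definition standing (phi c d f h : R -> R) : Prop :=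
  odd_incr_homeo phi /\
  (exists psi1 psi2, incr_homeo_pos psi1 /\ incr_homeo_pos psi2 /\
    (forall x y, 0 <= x -> 0 <= y ->
      phi x * psi1 y <= phi (x * y) /\ phi (x * y) <= phi x * psi2 y) /\
    h_integrability psi1 h) /\
  cont_on I01 c /\ (forall t, 0 <= t <= 1 -> 0 < c t) /\
  cont_on I01 d /\ (forall t, 0 <= t <= 1 -> 0 < d t) /\
  cont_on nonneg f /\ (forall s, 0 <= s -> 0 <= f s) /\ (forall s, 0 < s -> 0 < f s) /\
  cont_on O01 h /\ (forall t, 0 < t < 1 -> 0 <= h t) /\ (exists t, 0 < t < 1 /\ h t <> 0) /\
  gamma_hyp h.

(* Main.v *)
(* Only the existence of positive solutions of small (resp. large) norm for all large lambda
   has content: the theorem allows m_* = oo in (a) and m_* = 0 in (b).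

   Write w = d phi(c u') and g = phi^-1, so that u' = g(w/d)/c and w' = -lambda h f(u), and shoot
   from u(0) = 0, w(0) = s. Since f is only continuous, the initial value problem may
   branch, and h may fail to be integrable at 0 and 1. Both defects disappear if u is delayed by
   1/n inside f and h is replaced by a continuous cutoff below h: the delayed problem is solved
   by finitely many integrations and its solution depends continuously on s. If max u is a
   fixed R, then for lambda large, uniformly in n, the shot satisfies u(1) < 0, because u is
   bounded below by a multiple of t(1-t) max u whenever u(1) >= 0. If max u = m with f <= eps phi(m)
   on [0,m] and eps small, then u(1) > 0, by condition (A) and the integrability of h. In case (a)
   this applies to small m, in case (b) to large m, so the intermediate value theorem in s yields
   a delayed solution with u(1) = 0 and max u at most (resp. at least) R.

   As n -> oo the solutions and fluxes are equi-Lipschitz on compact subsets of (0,1), and the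
   integrability of h controls u uniformly at the endpoints. The limit is taken pointwise along
   a nonprincipal ultrafilter on nat, which replaces the Arzela-Ascoli theorem. *)
From Stdlib Require Import Reals Lra Lia Classical ClassicalEpsilon.
From mathcomp Require filter.
From Coquelicot Require Import Coquelicot.
Require Import Defs.
Open Scope R_scope.

(** * Calculus preliminaries *)


(** The estimates on shots use only the flux equation and the monotonicity of the flux ([profile]).
    Since [g] is odd, this class is stable under [t -> 1 - t], with the flux changing sign, so each
    bound is proved from the left end and then reflected. Condition (A) enters in two forms. Its
    lower half, read through the inverse, is [g (x * y) <= g x * p1 y] with [p1] the inverse of
    [psi1]: it compares rates belonging to different coefficients, and it extracts from [g] exactly
    the quantity that the hypothesis on [h] makes integrable. Its upper half serves in
    undershooting, to move a constant factor out of [phi]. Uniformity in [n] shapes the two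
    thresholds. Overshooting needs a lower bound on the weight, taken on one interval where all
    cutoffs exceed a common constant; undershooting needs only that the cutoffs stay below [h]. The
    overshooting level [R0] is fixed before [lam], while the undershooting level may depend on
    [lam]; this order makes the bound on the norm uniform for [lam > Lam]. *)

Lemma deriv_le_increment (x x' y y' : R -> R) (a b : R) :
  a <= b ->
  (forall t, a <= t <= b -> derivable_pt_lim x t (x' t)) ->
  (forall t, a <= t <= b -> derivable_pt_lim y t (y' t)) ->
  (forall t, a <= t <= b -> x' t <= y' t) ->
  x b - x a <= y b - y a.
Proof.
  intros Hab Hx Hy Hle.
  destruct (Req_dec a b) as [->|Hne]; [lra|].
  destruct (MVT_cor2 (fun t => y t - x t) (fun t => y' t - x' t) a b) as [m [Hm Hmab]].
  - lra.
  - intros t Ht; apply derivable_pt_lim_minus; auto.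
  - assert (0 <= (y' m - x' m) * (b - a)).
    { apply Rmult_le_pos; [|lra]. specialize (Hle m); lra. }
    lra.
Qed.

Lemma derivable_pt_lim_linear (k t : R) : derivable_pt_lim (fun s => k * s) t k.
Proof.
  pose proof (derivable_pt_lim_scal (fun s => s) k t 1 (derivable_pt_lim_id t)) as H.
  rewrite Rmult_1_r in H. exact H.
Qed.

Lemma deriv_ub_increment (x x' : R -> R) (K a b : R) :
  a <= b ->
  (forall t, a <= t <= b -> derivable_pt_lim x t (x' t)) ->
  (forall t, a <= t <= b -> x' t <= K) ->
  x b - x a <= K * (b - a).
Proof.
  intros Hab Hx Hle.
  pose proof (deriv_le_increment x x' (fun t => K * t) (fun _ => K) a b Hab Hx) as H.
  rewrite Rmult_minus_distr_l. apply H; auto.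
  intros; apply derivable_pt_lim_linear.
Qed.

Lemma deriv_lb_increment (x x' : R -> R) (K a b : R) :
  a <= b ->
  (forall t, a <= t <= b -> derivable_pt_lim x t (x' t)) ->
  (forall t, a <= t <= b -> K <= x' t) ->
  K * (b - a) <= x b - x a.
Proof.
  intros Hab Hx Hle.
  pose proof (deriv_le_increment (fun t => K * t) (fun _ => K) x x' a b Hab) as H.
  rewrite Rmult_minus_distr_l. apply H; auto.
  intros; apply derivable_pt_lim_linear.
Qed.

Lemma deriv_abs_increment (x x' : R -> R) (K a b : R) :
  (forall t, Rmin a b <= t <= Rmax a b -> derivable_pt_lim x t (x' t)) ->
  (forall t, Rmin a b <= t <= Rmax a b -> Rabs (x' t) <= K) ->
  Rabs (x b - x a) <= K * Rabs (b - a).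
Proof.
  intros Hx Hle.
  assert (Hgen : forall p q, p <= q ->
    (forall t, p <= t <= q -> derivable_pt_lim x t (x' t)) ->
    (forall t, p <= t <= q -> Rabs (x' t) <= K) ->
    Rabs (x q - x p) <= K * (q - p)).
  { intros p q Hpq Hd Hb. apply Rabs_le. split.
    - enough (- K * (q - p) <= x q - x p) by lra.
      apply deriv_lb_increment with x'; auto.
      intros t Ht; specialize (Hb t Ht); apply Rabs_le_between in Hb; lra.
    - apply deriv_ub_increment with x'; auto.
      intros t Ht; specialize (Hb t Ht); apply Rabs_le_between in Hb; lra. }
  destruct (Rle_dec a b) as [Hab|Hab].
  - rewrite Rmin_left, Rmax_right in * by lra.
    rewrite (Rabs_right (b - a)) by lra. auto.
  - rewrite Rmin_right, Rmax_left in * by lra.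
    rewrite (Rabs_minus_sym (x b)), (Rabs_minus_sym b), (Rabs_right (a - b)) by lra.
    apply Hgen; auto; lra.
Qed.

Lemma derivable_pt_lim_reflect (x : R -> R) (t l : R) :
  derivable_pt_lim x (1 - t) l -> derivable_pt_lim (fun s => x (1 - s)) t (- l).
Proof.
  intros H.
  replace (- l) with (l * (-1)) by ring.
  apply (derivable_pt_lim_comp (fun s => 1 - s) x).
  - replace (-1) with (0 - 1) by ring.
    apply (derivable_pt_lim_minus (fun _ => 1) (fun s => s));
      [apply derivable_pt_lim_const|apply derivable_pt_lim_id].
  - exact H.
Qed.

Lemma derivable_pt_lim_cont (x : R -> R) (t l : R) : derivable_pt_lim x t l -> continuity_pt x t.
Proof. intros H; apply derivable_continuous_pt; exists l; exact H. Qed.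

Lemma continuity_pt_eps (f : R -> R) (x : R) :
  continuity_pt f x <->
  (forall eps, 0 < eps -> exists del, 0 < del /\
     forall y, Rabs (y - x) < del -> Rabs (f y - f x) < eps).
Proof.
  split.
  - intros H eps He. destruct (H eps He) as [a [Ha H1]]. exists a; split; auto.
    intros y Hy. destruct (Req_dec y x) as [->|Hne].
    + rewrite Rminus_diag, Rabs_R0; auto.
    + apply H1. split; [split; [exact I|auto]|exact Hy].
  - intros H eps He. destruct (H eps He) as [a [Ha H1]]. exists a; split; auto.
    intros y [_ Hy]. apply H1, Hy.
Qed.

Lemma cont_on_retract (D : R -> Prop) (f r : R -> R) :
  cont_on D f -> continuity r -> (forall x, D (r x)) -> continuity (fun x => f (r x)).
Proof.
  intros Hf Hr HD x. apply continuity_pt_eps. intros eps He.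
  destruct (Hf (r x) (HD x) eps He) as [d1 [Hd1 H1]].
  destruct (proj1 (continuity_pt_eps r x) (Hr x) d1 Hd1) as [d2 [Hd2 H2]].
  exists d2; split; auto.
Qed.

Lemma cont_on_open (f : R -> R) (t : R) : cont_on O01 f -> 0 < t < 1 -> continuity_pt f t.
Proof.
  intros Hf Ht. apply continuity_pt_eps. intros eps He.
  destruct (Hf t Ht eps He) as [d [Hd H]].
  exists (Rmin d (Rmin t (1 - t))). split.
  - repeat apply Rmin_glb_lt; lra.
  - intros y Hy. apply H.
    + pose proof (Rmin_r d (Rmin t (1 - t))). pose proof (Rmin_l t (1 - t)).
      pose proof (Rmin_r t (1 - t)). apply Rabs_def2 in Hy. unfold O01. lra.
    + pose proof (Rmin_l d (Rmin t (1 - t))). lra.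
Qed.

Lemma continuity_pt_Rmax (f g : R -> R) (x : R) :
  continuity_pt f x -> continuity_pt g x -> continuity_pt (fun x => Rmax (f x) (g x)) x.
Proof.
  rewrite !continuity_pt_eps. intros Hf Hg eps He.
  destruct (Hf eps He) as [d1 [Hd1 H1]], (Hg eps He) as [d2 [Hd2 H2]].
  exists (Rmin d1 d2). split; [apply Rmin_glb_lt; auto|].
  intros y Hy.
  specialize (H1 y (Rlt_le_trans _ _ _ Hy (Rmin_l _ _))).
  specialize (H2 y (Rlt_le_trans _ _ _ Hy (Rmin_r _ _))).
  apply Rabs_def2 in H1. apply Rabs_def2 in H2.
  apply Rabs_def1; unfold Rmax; repeat destruct Rle_dec; lra.
Qed.

Lemma continuity_pt_Rmin (f g : R -> R) (x : R) :
  continuity_pt f x -> continuity_pt g x -> continuity_pt (fun x => Rmin (f x) (g x)) x.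
Proof.
  intros Hf Hg.
  apply continuity_pt_ext with (fun x => - Rmax (- f x) (- g x)).
  - intros y. rewrite Rmax_opp_Rmin. ring.
  - apply (continuity_pt_opp (fun x => Rmax (- f x) (- g x))), continuity_pt_Rmax;
      apply continuity_pt_opp; auto.
Qed.

Lemma continuity_cst (k : R) : continuity (fun _ => k).
Proof. intros x; apply continuity_pt_const; intros a b; reflexivity. Qed.

Lemma continuity_idf : continuity (fun x => x).
Proof. intros x; apply derivable_continuous_pt, derivable_pt_id. Qed.

(** Precomposing [c] and [d] with this retraction gives coefficients that are continuous, positive
    and bounded on the whole line, so that profiles can be followed at the negative times reached by
    the delay. *)
Definition clamp (t : R) : R := Rmax 0 (Rmin t 1).

Lemma clamp_in (t : R) : 0 <= clamp t <= 1.
Proof. unfold clamp, Rmax, Rmin; repeat destruct Rle_dec; lra. Qed.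

Lemma clamp_id (t : R) : 0 <= t <= 1 -> clamp t = t.
Proof. intros; unfold clamp, Rmax, Rmin; repeat destruct Rle_dec; lra. Qed.

Lemma continuity_clamp : continuity clamp.
Proof.
  intros t. apply continuity_pt_Rmax; [apply continuity_cst|].
  apply continuity_pt_Rmin; [apply continuity_idf|apply continuity_cst].
Qed.

Lemma cont_on_bounds (c : R -> R) :
  cont_on I01 c -> (forall t, 0 <= t <= 1 -> 0 < c t) ->
  continuity (fun t => c (clamp t)) /\
  exists m M, 0 < m /\ 0 < M /\ forall t, m <= c (clamp t) <= M.
Proof.
  intros Hc Hpos.
  assert (Hcont : continuity (fun t => c (clamp t))).
  { apply cont_on_retract with I01; auto using continuity_clamp. apply clamp_in. }
  split; auto.
  destruct (continuity_ab_maj (fun t => c (clamp t)) 0 1) as [xM [HM _]]; [lra|auto|].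
  destruct (continuity_ab_min (fun t => c (clamp t)) 0 1) as [xm [Hm _]]; [lra|auto|].
  exists (c (clamp xm)), (c (clamp xM)).
  split; [apply Hpos, clamp_in|]. split; [apply Hpos, clamp_in|].
  intros t.
  specialize (HM (clamp t) (clamp_in t)). specialize (Hm (clamp t) (clamp_in t)).
  cbv beta in HM, Hm. rewrite (clamp_id (clamp t)) in HM, Hm by apply clamp_in. lra.
Qed.

Lemma primitive_of_continuous (f : R -> R) :
  continuity f -> exists F, F 0 = 0 /\ forall t, derivable_pt_lim F t (f t).
Proof.
  intros Hf.
  assert (Hc : forall z, continuous f z) by (intros z; apply continuity_pt_filterlim, Hf).
  exists (fun t => Coquelicot.RInt.RInt f 0 t). split.
  - apply (RInt_point (V := R_CompleteNormedModule)).
  - intros t. apply is_derive_Reals.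
    apply is_derive_RInt with (a := 0); [|apply Hc].
    apply filter_forall. intros b. apply (RInt_correct (V := R_CompleteNormedModule)).
    apply (ex_RInt_continuous (V := R_CompleteNormedModule)). auto.
Qed.

(** The base point is interior because [f] may fail to be integrable at 0 and 1. *)
Lemma primitive_on_open (f : R -> R) :
  (forall t, 0 < t < 1 -> continuity_pt f t) ->
  forall t, 0 < t < 1 ->
    derivable_pt_lim (fun s => Coquelicot.RInt.RInt f (1/2) s) t (f t) /\
    ex_RInt f (1/2) t.
Proof.
  intros Hf.
  assert (Hex : forall b, 0 < b < 1 -> ex_RInt f (1/2) b).
  { intros b Hb. apply (ex_RInt_continuous (V := R_CompleteNormedModule)). intros z Hz.
    apply continuity_pt_filterlim, Hf.
    revert Hz; unfold Rmin, Rmax; destruct Rle_dec; lra. }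
  intros t Ht. split; auto.
  apply is_derive_Reals.
  apply is_derive_RInt with (a := 1/2); [|apply continuity_pt_filterlim, Hf, Ht].
  assert (Hd : 0 < Rmin t (1 - t)) by (apply Rmin_glb_lt; lra).
  exists (mkposreal _ Hd). intros b Hb.
  apply (RInt_correct (V := R_CompleteNormedModule)), Hex.
  unfold ball in Hb; simpl in Hb; unfold AbsRing_ball, abs, minus, plus, opp in Hb; simpl in Hb.
  apply Rabs_def2 in Hb.
  pose proof (Rmin_l t (1 - t)); pose proof (Rmin_r t (1 - t)). lra.
Qed.

Lemma Defs_RInt_eq (f : R -> R) (a b : R) :
  ex_RInt f a b -> Defs.RInt f a b = Coquelicot.RInt.RInt f a b.
Proof.
  intros Hex. unfold Defs.RInt. destruct excluded_middle_informative as [H|H].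
  - symmetry. apply Coquelicot.RInt.RInt_Reals.
  - exfalso; apply H. constructor. apply ex_RInt_Reals_0, Hex.
Qed.

(** Strict monotonicity squeezes [g z] between [g y - eps/2] and [g y + eps/2] once [z] lies between
    the values of [f] at these points. If one of them is outside [D], convexity of [D] already keeps
    [g z] within [eps] on that side. *)
Lemma inverse_continuous (D : R -> Prop) (f g : R -> R) :
  (forall x y, D x -> D y -> x <= y -> forall z, x <= z <= y -> D z) ->
  (forall x y, D x -> D y -> x < y -> f x < f y) ->
  (forall y, D y -> D (g y) /\ f (g y) = y) ->
  (forall x, D x -> D (f x)) ->
  cont_on D g.
Proof.
  intros Hconv Hf Hg HD y Dy eps He.
  destruct (Hg y Dy) as [Dgy Hfgy].
  assert (Hlow : exists d, 0 < d /\ forall z, D z -> y - d < z -> g y - eps < g z).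
  { destruct (classic (D (g y - eps/2))) as [Dl|Dl].
    - exists (y - f (g y - eps/2)). split.
      + assert (f (g y - eps/2) < f (g y)) by (apply Hf; auto; lra). lra.
      + intros z Dz Hz. destruct (Hg z Dz) as [Dgz Hfgz].
        destruct (Rlt_dec (g y - eps/2) (g z)) as [|Hn]; [lra|].
        destruct (Req_dec (g z) (g y - eps/2)) as [E|E]; [lra|].
        assert (f (g z) < f (g y - eps/2)) by (apply Hf; auto; lra). lra.
    - exists 1; split; [lra|]. intros z Dz _. destruct (Hg z Dz) as [Dgz _].
      destruct (Rlt_dec (g y - eps) (g z)) as [|Hn]; auto.
      exfalso; apply Dl. apply (Hconv (g z) (g y)); auto; lra. }
  assert (Hup : exists d, 0 < d /\ forall z, D z -> z < y + d -> g z < g y + eps).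
  { destruct (classic (D (g y + eps/2))) as [Dl|Dl].
    - exists (f (g y + eps/2) - y). split.
      + assert (f (g y) < f (g y + eps/2)) by (apply Hf; auto; lra). lra.
      + intros z Dz Hz. destruct (Hg z Dz) as [Dgz Hfgz].
        destruct (Rlt_dec (g z) (g y + eps/2)) as [|Hn]; [lra|].
        destruct (Req_dec (g z) (g y + eps/2)) as [E|E]; [lra|].
        assert (f (g y + eps/2) < f (g z)) by (apply Hf; auto; lra). lra.
    - exists 1; split; [lra|]. intros z Dz _. destruct (Hg z Dz) as [Dgz _].
      destruct (Rlt_dec (g z) (g y + eps)) as [|Hn]; auto.
      exfalso; apply Dl. apply (Hconv (g y) (g z)); auto; lra. }
  destruct Hlow as [d1 [Hd1 H1]], Hup as [d2 [Hd2 H2]].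
  exists (Rmin d1 d2). split; [apply Rmin_glb_lt; auto|].
  intros z Dz Hz. pose proof (Rmin_l d1 d2). pose proof (Rmin_r d1 d2).
  apply Rabs_def2 in Hz.
  specialize (H1 z Dz). specialize (H2 z Dz). apply Rabs_def1; lra.
Qed.

(** Refining [eventually] is what makes the ultrafilter nonprincipal. It comes from the ultrafilter
    lemma of mathcomp; the rest restates the filter axioms in the form of [ProperFilter]. *)
Lemma nat_ultrafilter :
  exists U : (nat -> Prop) -> Prop,
    ProperFilter U /\ filter_le U eventually /\
    forall P, U P \/ U (fun n => ~ P n).
Proof.
  destruct (@filter.ultraFilterLemma nat _ filter.eventually_filter) as [G [HG HGe]].
  exists G.
  pose proof (@filter.ultra_proper _ _ HG) as HP.
  pose proof (@filter.filter_filter _ _ HP) as HF.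
  split; [|split].
  - constructor.
    + intros P HGP. apply NNPP. intros Hn.
      apply (@filter.filter_not_empty _ _ HP).
      apply (@filter.filterS _ _ HF P); auto. intros n Pn. apply Hn. exists n; exact Pn.
    + constructor.
      * exact (@filter.filterT _ _ HF).
      * intros P Q; exact (@filter.filterI _ _ HF P Q).
      * intros P Q HPQ; exact (@filter.filterS _ _ HF P Q HPQ).
  - intros P [N HN]. apply HGe. exists N; [exact I|].
    intros n Hn. apply HN. apply (ssrbool.elimT ssrnat.leP Hn).
  - intros P. exact (@filter.in_ultra_setVsetC nat G P HG).
Qed.

(** The limit [l] is the supremum of the [x] below [a n] for [U]-most [n]. As [U] decides both
    [l - eps / 2 <= a n] and [l + eps / 2 <= a n], the choice of [l] forces the first to hold and
    the second to fail. *)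
Lemma ultra_lim (U : (nat -> Prop) -> Prop) (a : nat -> R) (B : R) :
  ProperFilter U -> (forall P, U P \/ U (fun n => ~ P n)) ->
  (forall n, Rabs (a n) <= B) -> exists l, filterlim a U (locally l).
Proof.
  intros PF Hu Hb.
  destruct (completeness (fun x => U (fun n => x <= a n))) as [l [Hub Hlub]].
  - exists (B + 1). intros x Hx.
    destruct (Rle_dec x (B + 1)) as [|Hn]; auto. exfalso.
    apply (@filter_not_empty _ U _). revert Hx. apply filter_imp. intros n Hn'.
    specialize (Hb n). apply Rabs_le_between in Hb. lra.
  - exists (- B). apply filter_forall. intros n.
    specialize (Hb n). apply Rabs_le_between in Hb. lra.
  - exists l. intros P [eps HP]. unfold filtermap.
    assert (He := cond_pos eps).
    assert (H1 : U (fun n => l - eps / 2 <= a n)).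
    { destruct (Hu (fun n => l - eps / 2 <= a n)) as [|Hn]; auto. exfalso.
      enough (l <= l - eps / 2) by lra. apply Hlub. intros x Hx.
      destruct (Rle_dec x (l - eps / 2)) as [|Hx']; auto. exfalso.
      apply (@filter_not_empty _ U _). generalize (filter_and _ _ Hn Hx).
      apply filter_imp. intros n [? ?]; lra. }
    assert (H2 : U (fun n => ~ l + eps / 2 <= a n)).
    { destruct (Hu (fun n => l + eps / 2 <= a n)) as [Hn|]; auto. exfalso.
      specialize (Hub _ Hn). lra. }
    generalize (filter_and _ _ H1 H2). apply filter_imp.
    intros n [? ?]. apply HP.
    change (Rabs (a n - l) < eps). apply Rabs_def1; lra.
Qed.

(** * A priori bounds for profiles *)


Section Profiles.

Context (g p1 : R -> R).
Context (g_odd : forall x, g (- x) = - g x).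
Context (g_incr : forall x y, x < y -> g x < g y).
Context (p1_nonneg : forall y, 0 <= y -> 0 <= p1 y).
Context (g_mul : forall x y, 0 <= x -> 0 <= y -> g (x * y) <= g x * p1 y).
Context (cm cM dm dM : R).

Definition coeffs (c d : R -> R) : Prop :=
  0 < cm /\ 0 < dm /\ forall t, cm <= c t <= cM /\ dm <= d t <= dM.

(** All that the bounds keep of the equation: monotonicity of the flux stands for
    [w' = - lam h f(u) <= 0], so bounds on profiles mention neither [f] nor [lam]. *)
Definition profile (c d u w : R -> R) : Prop :=
  (forall t, derivable_pt_lim u t (g (w t / d t) / c t)) /\
  (forall s t, s <= t -> w t <= w s).

Lemma g0 : g 0 = 0.
Proof. pose proof (g_odd 0) as H. rewrite Ropp_0 in H. lra. Qed.

Lemma g_le (x y : R) : x <= y -> g x <= g y.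
Proof. intros [H| ->]; [left; auto|right; auto]. Qed.

Lemma g_nonneg (x : R) : 0 <= x -> 0 <= g x.
Proof. intros H. rewrite <- g0. apply g_le, H. Qed.

Lemma coeffs_reflect (c d : R -> R) :
  coeffs c d -> coeffs (fun t => c (1 - t)) (fun t => d (1 - t)).
Proof. intros (H1 & H2 & H3). repeat split; auto; apply H3. Qed.

Lemma coeffs_pos (c d : R -> R) : coeffs c d -> 0 < cm /\ 0 < dm /\ 0 < cM /\ 0 < dM.
Proof. intros (H1 & H2 & H3). specialize (H3 0). lra. Qed.

Lemma profile_reflect (c d u w : R -> R) :
  profile c d u w ->
  profile (fun t => c (1 - t)) (fun t => d (1 - t)) (fun t => u (1 - t)) (fun t => - w (1 - t)).
Proof.
  intros [Hu Hw]. split.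
  - intros t. replace (- w (1 - t) / d (1 - t)) with (- (w (1 - t) / d (1 - t)))
      by (unfold Rdiv; ring).
    rewrite g_odd.
    replace (- g (w (1 - t) / d (1 - t)) / c (1 - t))
      with (- (g (w (1 - t) / d (1 - t)) / c (1 - t))) by (unfold Rdiv; ring).
    apply derivable_pt_lim_reflect, Hu.
  - intros s t Hst. specialize (Hw (1 - t) (1 - s)). lra.
Qed.

Lemma Rdiv_le_compat (a b x y : R) : 0 <= a <= b -> 0 < x <= y -> a / y <= b / x.
Proof.
  intros Ha Hx. unfold Rdiv. apply Rmult_le_compat; try lra.
  - left; apply Rinv_0_lt_compat; lra.
  - apply Rinv_le_contravar; lra.
Qed.

Lemma Rdiv_nonneg (a x : R) : 0 <= a -> 0 < x -> 0 <= a / x.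
Proof. intros; apply Rmult_le_pos; auto. left; apply Rinv_0_lt_compat; auto. Qed.

Lemma rate_lower (c d : R -> R) (t x y : R) :
  coeffs c d -> 0 <= y <= x -> g (y / dM) / cM <= g (x / d t) / c t.
Proof.
  intros (Hc & Hd & Hb) Hxy. specialize (Hb t).
  apply Rdiv_le_compat; [|lra]. split.
  - apply g_nonneg, Rdiv_nonneg; lra.
  - apply g_le, Rdiv_le_compat; lra.
Qed.

Lemma rate_upper (c d : R -> R) (t x y : R) :
  coeffs c d -> x <= y -> 0 <= y -> g (x / d t) / c t <= g (y / dm) / cm.
Proof.
  intros (Hc & Hd & Hb) Hxy Hy. specialize (Hb t).
  destruct (Rle_dec 0 x) as [Hx|Hx].
  - apply Rdiv_le_compat; [|lra]. split.
    + apply g_nonneg, Rdiv_nonneg; lra.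
    + apply g_le, Rdiv_le_compat; lra.
  - apply Rle_trans with 0.
    + assert (0 <= - g (x / d t) / c t); [|unfold Rdiv in *; lra].
      apply Rdiv_nonneg; [|lra]. rewrite <- g_odd. apply g_nonneg.
      replace (- (x / d t)) with ((- x) / d t) by (unfold Rdiv; ring).
      apply Rdiv_nonneg; lra.
    + apply Rdiv_nonneg; [|lra]. apply g_nonneg, Rdiv_nonneg; lra.
Qed.

Lemma rise_lower (c d u w : R -> R) (a b : R) :
  coeffs c d -> profile c d u w -> a <= b -> 0 <= w b ->
  g (w b / dM) / cM * (b - a) <= u b - u a.
Proof.
  intros Hc [Hu Hw] Hab Hwb. eapply deriv_lb_increment; [auto|intros t Ht; apply Hu|].
  intros t Ht. apply rate_lower; auto. split; auto. apply Hw; lra.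
Qed.

Lemma rise_upper (c d u w : R -> R) (a b : R) :
  coeffs c d -> profile c d u w -> a <= b -> 0 <= w a ->
  u b - u a <= g (w a / dm) / cm * (b - a).
Proof.
  intros Hc [Hu Hw] Hab Hwb. eapply deriv_ub_increment; [auto|intros t Ht; apply Hu|].
  intros t Ht. apply rate_upper; auto. apply Hw; lra.
Qed.

(** This is [rise_lower] for the reflected profile, whose flux at [1 - a] is [- w a >= 0]. *)
Lemma fall (c d u w : R -> R) (a b : R) :
  coeffs c d -> profile c d u w -> a <= b -> w a <= 0 -> u b <= u a.
Proof.
  intros Hc Hp Hab Hwa.
  pose proof (rise_lower _ _ _ _ (1 - b) (1 - a) (coeffs_reflect _ _ Hc)
    (profile_reflect _ _ _ _ Hp)) as H. cbv beta in H.
  replace (1 - (1 - a)) with a in H by ring. replace (1 - (1 - b)) with b in H by ring.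
  assert (0 <= g (- w a / dM) / cM * (1 - a - (1 - b))); [|lra].
  destruct (coeffs_pos _ _ Hc) as (? & ? & ? & ?).
  apply Rmult_le_pos; [|lra]. apply Rdiv_nonneg; [|lra]. apply g_nonneg, Rdiv_nonneg; lra.
Qed.

(** If the flux at [t] is nonnegative, it was so before and [u] has risen from [u 0]; otherwise it
    stays negative and [u] falls to [u 1]. *)
Lemma profile_nonneg (c d u w : R -> R) (t : R) :
  coeffs c d -> profile c d u w -> 0 <= u 0 -> 0 <= u 1 -> 0 <= t <= 1 -> 0 <= u t.
Proof.
  intros Hc Hp H0 H1 Ht. destruct (Rle_dec 0 (w t)) as [Hw|Hw].
  - pose proof (rise_lower c d u w 0 t Hc Hp (proj1 Ht) Hw).
    destruct (coeffs_pos _ _ Hc) as (? & ? & ? & ?).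
    assert (0 <= g (w t / dM) / cM * (t - 0)); [|lra].
    apply Rmult_le_pos; [|lra]. apply Rdiv_nonneg; [|lra]. apply g_nonneg, Rdiv_nonneg; lra.
  - pose proof (fall c d u w t 1 Hc Hp (proj2 Ht)). lra.
Qed.

(** At a given flux [w >= 0] the coefficients allow rates between [g (w / dM) / cM] and
    [g (w / dm) / cm]; by [g_mul] with [y = dM / dm] their ratio is at most the second summand. The
    1 accounts for [u t] in [u s = u t + (u s - u t)]. *)
Definition cone_const : R := 1 + p1 (dM / dm) * cM / cm.

Lemma cone_const_ge1 (c d : R -> R) : coeffs c d -> 1 <= cone_const.
Proof.
  intros Hc. destruct (coeffs_pos _ _ Hc) as (? & ? & ? & ?). unfold cone_const.
  assert (0 <= p1 (dM / dm) * cM / cm); [|lra].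
  apply Rdiv_nonneg; [|lra]. apply Rmult_le_pos; [|lra]. apply p1_nonneg, Rdiv_nonneg; lra.
Qed.

(** The flux is at least [w t] before [t] and at most [w t] after. If [w t >= 0], the rate on
    [[t, s]] therefore exceeds the one on [[0, t]] at most by the ratio in [cone_const]; if
    [w t < 0], then [u s <= u t]. *)
Lemma cone_left (c d u w : R -> R) (t s : R) :
  coeffs c d -> profile c d u w -> 0 <= u 0 -> 0 <= u 1 -> 0 <= t <= s -> s <= 1 ->
  t * u s <= cone_const * u t.
Proof.
  intros Hc Hp H0 H1 Ht Hs.
  pose proof (profile_nonneg c d u w t Hc Hp H0 H1 ltac:(lra)) as Hut.
  pose proof (cone_const_ge1 _ _ Hc) as HC.
  destruct (coeffs_pos _ _ Hc) as (Hcm & Hdm & HcM & HdM).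
  destruct (Rle_dec 0 (w t)) as [Hw|Hw].
  - pose proof (rise_lower c d u w 0 t Hc Hp ltac:(lra) Hw) as HL.
    pose proof (rise_upper c d u w t s Hc Hp ltac:(lra) Hw) as HU.
    set (X := w t / dM) in *.
    assert (HX : 0 <= X) by (apply Rdiv_nonneg; lra).
    assert (Hk : w t / dm = X * (dM / dm)) by (unfold X; field; lra).
    pose proof (g_mul X (dM / dm) HX ltac:(apply Rdiv_nonneg; lra)) as Hg.
    rewrite <- Hk in Hg.
    pose proof (g_nonneg X HX) as HgX.
    assert (Hpk : 0 <= p1 (dM / dm)) by (apply p1_nonneg, Rdiv_nonneg; lra).
    set (C := p1 (dM / dm) * cM / cm) in *.
    assert (HC0 : 0 <= C).
    { unfold C. apply Rdiv_nonneg; [|lra]. apply Rmult_le_pos; lra. }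
    assert (E1 : g (w t / dm) / cm <= C * (g X / cM)).
    { replace (C * (g X / cM)) with (g X * p1 (dM / dm) / cm) by (unfold C; field; lra).
      unfold Rdiv. apply Rmult_le_compat_r; auto. left; apply Rinv_0_lt_compat; lra. }
    assert (HgM : 0 <= g X / cM) by (apply Rdiv_nonneg; lra).
    assert (E2 : u s - u t <= C * (g X / cM) * 1).
    { apply Rle_trans with (g (w t / dm) / cm * (s - t)); auto.
      apply Rmult_le_compat; try lra.
      apply Rdiv_nonneg; [|lra]. apply g_nonneg, Rdiv_nonneg; lra. }
    assert (E3 : t * (u s - u t) <= C * u t).
    { apply Rle_trans with (t * (C * (g X / cM) * 1)).
      - apply Rmult_le_compat_l; lra.
      - replace (t * (C * (g X / cM) * 1)) with (C * (g X / cM * (t - 0))) by ring.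
        apply Rmult_le_compat_l; lra. }
    unfold cone_const. fold C. nra.
  - pose proof (fall c d u w t s Hc Hp ltac:(lra)) as HL.
    assert (u s <= u t) by (apply HL; lra).
    apply Rle_trans with (1 * u t); [nra|]. apply Rmult_le_compat_r; lra.
Qed.

(* Replaces the concavity inequality [u t >= min t (1-t) * max u], which fails for a general weight. *)
Lemma cone (c d u w : R -> R) (t s : R) :
  coeffs c d -> profile c d u w -> 0 <= u 0 -> 0 <= u 1 -> 0 <= t <= 1 -> 0 <= s <= 1 ->
  t * (1 - t) * u s <= cone_const * u t.
Proof.
  intros Hc Hp H0 H1 Ht Hs.
  pose proof (profile_nonneg c d u w t Hc Hp H0 H1 Ht) as Hut.
  pose proof (profile_nonneg c d u w s Hc Hp H0 H1 Hs) as Hus.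
  pose proof (cone_const_ge1 _ _ Hc) as HC.
  destruct (Rle_dec t s) as [Hts|Hts].
  - pose proof (cone_left c d u w t s Hc Hp H0 H1 ltac:(lra) ltac:(lra)).
    assert (0 <= t * u s) by (apply Rmult_le_pos; lra).
    apply Rle_trans with (t * u s); auto. nra.
  - pose proof (cone_left _ _ _ _ (1 - t) (1 - s) (coeffs_reflect _ _ Hc)
      (profile_reflect _ _ _ _ Hp)) as H. cbv beta in H.
    replace (1 - (1 - t)) with t in H by ring. replace (1 - (1 - s)) with s in H by ring.
    replace (1 - 0) with 1 in H by ring. replace (1 - 1) with 0 in H by ring.
    specialize (H H1 H0 ltac:(lra) ltac:(lra)).
    assert (0 <= (1 - t) * u s) by (apply Rmult_le_pos; lra).
    apply Rle_trans with ((1 - t) * u s); auto. nra.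
Qed.

(** The flux drops at rate [Q] between the first quarter point and the midpoint, where it is still
    nonnegative. So it is at least [Q * ((q - p) / 4)] on the first quarter, and [u] climbs there by
    at least the left-hand side. *)
Lemma expansion_left (c d u w : R -> R) (p q Q R : R) :
  coeffs c d -> profile c d u w -> p < q -> 0 <= Q ->
  (forall a b, p <= a -> a <= b -> b <= q -> Q * (b - a) <= w a - w b) ->
  (forall t, p <= t <= q -> 0 <= u t <= R) ->
  0 <= w ((p + q) / 2) ->
  g (Q * ((q - p) / 4) / dM) / cM * ((q - p) / 4) <= R.
Proof.
  intros Hc Hp Hpq HQ Hdrop Hu Hmid.
  destruct (coeffs_pos _ _ Hc) as (Hcm & Hdm & HcM & HdM).
  set (b := p + (q - p) / 4).
  assert (Hwb : Q * ((q - p) / 4) <= w b).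
  { pose proof (Hdrop b ((p + q) / 2) ltac:(unfold b; lra) ltac:(unfold b; lra) ltac:(lra)) as H.
    replace ((p + q) / 2 - b) with ((q - p) / 4) in H by (unfold b; field). lra. }
  assert (H0 : 0 <= Q * ((q - p) / 4)) by (apply Rmult_le_pos; lra).
  pose proof (rise_lower c d u w p b Hc Hp ltac:(unfold b; lra) ltac:(lra)) as H.
  pose proof (Hu b ltac:(unfold b; lra)). pose proof (Hu p ltac:(lra)).
  apply Rle_trans with (g (w b / dM) / cM * (b - p)); [|lra].
  replace (b - p) with ((q - p) / 4) by (unfold b; ring).
  apply Rmult_le_compat_r; [lra|].
  apply Rdiv_le_compat; [|lra]. split.
  - apply g_nonneg, Rdiv_nonneg; lra.
  - apply g_le, Rdiv_le_compat; lra.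
Qed.

(** If the flux at the midpoint is negative, the reflected profile has a positive one there, and
    [expansion_left] applies to it. *)
Lemma expansion (c d u w : R -> R) (p q Q R : R) :
  coeffs c d -> profile c d u w -> p < q -> 0 <= Q ->
  (forall a b, p <= a -> a <= b -> b <= q -> Q * (b - a) <= w a - w b) ->
  (forall t, p <= t <= q -> 0 <= u t <= R) ->
  g (Q * ((q - p) / 4) / dM) / cM * ((q - p) / 4) <= R.
Proof.
  intros Hc Hp Hpq HQ Hdrop Hu.
  destruct (Rle_dec 0 (w ((p + q) / 2))) as [Hw|Hw].
  - apply (expansion_left c d u w p q Q R); auto.
  - pose proof (expansion_left _ _ _ _ (1 - q) (1 - p) Q R (coeffs_reflect _ _ Hc)
      (profile_reflect _ _ _ _ Hp)) as H. cbv beta in H.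
    replace (1 - p - (1 - q)) with (q - p) in H by ring.
    apply H; try lra.
    + intros a b Ha Hab Hb. specialize (Hdrop (1 - b) (1 - a)). lra.
    + intros t Ht. apply Hu. lra.
    + replace (1 - (1 - q + (1 - p)) / 2) with ((p + q) / 2) by field. lra.
Qed.

(** With [H] a primitive of [h] and [p1] the inverse of [psi1], [J] is a primitive of the integrand
    in the hypothesis on [h] and [l] its limit at 0. So [J t - l] encodes the improper integral over
    [(0, t)]. [Rmax 0] keeps the argument of [p1] nonnegative beyond 1/2. *)
Definition half_primitive (H J : R -> R) (l : R) : Prop :=
  (forall s, 0 < s < 1 -> derivable_pt_lim J s (p1 (Rmax 0 (H (1/2) - H s)))) /\
  (forall s, 0 < s < 1 -> l <= J s) /\
  (forall eps, 0 < eps -> exists del, 0 < del /\ forall s, 0 < s < del -> s < 1 -> J s < l + eps).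

(** The flux at [s] is at most [W + A * (H (1/2) - H s)]. It may be unbounded near 0, but the
    resulting bound on [u'] is a constant plus a multiple of the derivative of [J], whose integral
    down to 0 is finite. *)
Lemma half_bound (c d u w H J : R -> R) (l A W t : R) :
  coeffs c d -> profile c d u w -> half_primitive H J l ->
  0 <= A -> 0 <= W -> u 0 <= 0 -> w (1/2) <= W ->
  (forall s, 0 < s <= 1/2 -> w s - w (1/2) <= A * (H (1/2) - H s)) ->
  0 < t <= 1/2 ->
  u t <= (g (2 * W / dm) * t + g (2 * A / dm) * (J t - l)) / cm.
Proof.
  intros Hc Hp (HJ & Hl & _) HA HW H0 Hw Hdrop Ht.
  destruct (coeffs_pos _ _ Hc) as (Hcm & Hdm & HcM & HdM).
  set (K1 := g (2 * W / dm) / cm). set (K2 := g (2 * A / dm) / cm).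
  assert (HK1 : 0 <= K1).
  { apply Rdiv_nonneg; auto. apply g_nonneg, Rdiv_nonneg; lra. }
  assert (HK2 : 0 <= K2).
  { apply Rdiv_nonneg; auto. apply g_nonneg, Rdiv_nonneg; lra. }
  assert (Hinc : forall e, 0 < e <= t -> u t - u e <= K1 * (t - e) + K2 * (J t - J e)).
  { intros e He.
    pose proof (deriv_le_increment u _ (fun s => K1 * s + K2 * J s)
      (fun s => K1 + K2 * p1 (Rmax 0 (H (1/2) - H s))) e t (proj2 He)
      (fun s _ => proj1 Hp s)) as Hm.
    cbv beta in Hm.
    apply Rle_trans with (K1 * t + K2 * J t - (K1 * e + K2 * J e)); [|lra].
    apply Hm; clear Hm.
    - intros s Hs. apply (derivable_pt_lim_plus (fun s => K1 * s) (fun s => K2 * J s)).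
      + apply derivable_pt_lim_linear.
      + apply (derivable_pt_lim_scal J), HJ. lra.
    - intros s Hs.
      set (Y := Rmax 0 (H (1/2) - H s)).
      assert (HY : 0 <= Y) by apply Rmax_l.
      assert (Hws : w s <= W + A * Y).
      { specialize (Hdrop s ltac:(lra)).
        assert (A * (H (1/2) - H s) <= A * Y); [|lra].
        apply Rmult_le_compat_l; auto. apply Rmax_r. }
      assert (HAY : 0 <= A * Y) by (apply Rmult_le_pos; auto).
      apply Rle_trans with (g ((W + A * Y) / dm) / cm).
      { apply rate_upper; auto; lra. }
      replace (K1 + K2 * p1 Y) with ((g (2 * W / dm) + g (2 * A / dm) * p1 Y) / cm)
        by (unfold K1, K2; field; lra).
      unfold Rdiv at 1 3. apply Rmult_le_compat_r; [left; apply Rinv_0_lt_compat; auto|].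
      assert (Hm1 : 0 <= g (2 * W / dm)) by (apply g_nonneg, Rdiv_nonneg; lra).
      assert (Hm2 : g (2 * A / dm * Y) <= g (2 * A / dm) * p1 Y).
      { apply g_mul; auto. apply Rdiv_nonneg; lra. }
      assert (Hm3 : 0 <= g (2 * A / dm * Y)).
      { apply g_nonneg. apply Rmult_le_pos; auto. apply Rdiv_nonneg; lra. }
      (* [g] need not be subadditive; the sum [W + A * Y] is at most twice its larger term, whence
         the factors 2 in the bound. *)
      destruct (Rle_dec W (A * Y)) as [Hc1|Hc1].
      + assert (g ((W + A * Y) / dm) <= g (2 * A / dm * Y)); [|lra].
        apply g_le. replace (2 * A / dm * Y) with ((2 * (A * Y)) / dm) by (field; lra).
        apply Rdiv_le_compat; lra.
      + assert (g ((W + A * Y) / dm) <= g (2 * W / dm)); [|lra].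
        apply g_le, Rdiv_le_compat; lra. }
  replace ((g (2 * W / dm) * t + g (2 * A / dm) * (J t - l)) / cm)
    with (K1 * t + K2 * (J t - l)) by (unfold K1, K2; field; lra).
  (* [Hinc] starts at some [e > 0], since [J] is controlled only inside (0,1); continuity of [u] at
     0 and [l <= J e] allow [e] to tend to 0. *)
  apply Rle_plus_epsilon. intros eps Heps.
  pose proof (derivable_pt_lim_cont u 0 _ (proj1 Hp 0)) as Hcont.
  destruct (proj1 (continuity_pt_eps u 0) Hcont eps Heps) as [del [Hdel Hd]].
  set (e := Rmin (del / 2) t).
  assert (He : 0 < e <= t).
  { unfold e. split; [apply Rmin_glb_lt; lra|apply Rmin_r]. }
  assert (Hed : e < del) by (unfold e; pose proof (Rmin_l (del / 2) t); lra).
  specialize (Hinc e He). specialize (Hl e ltac:(lra)).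
  assert (Hue : Rabs (u e - u 0) < eps).
  { apply Hd. rewrite Rminus_0_r, Rabs_right; lra. }
  apply Rabs_def2 in Hue.
  assert (K1 * (t - e) <= K1 * t) by (apply Rmult_le_compat_l; lra).
  assert (K2 * (J t - J e) <= K2 * (J t - l)) by (apply Rmult_le_compat_l; lra).
  lra.
Qed.

(** With [w (1/2) <= 0], [half_bound] holds for [W = 0] and loses its first term. Before 1/2 the
    remaining bound is nondecreasing, and after 1/2 [u] falls, so the bound at 1/2 serves
    everywhere. *)
Lemma compression_left (c d u w H J : R -> R) (l A t : R) :
  coeffs c d -> profile c d u w -> half_primitive H J l ->
  0 <= A -> u 0 <= 0 -> w (1/2) <= 0 ->
  (forall s, 0 < s <= 1/2 -> w s - w (1/2) <= A * (H (1/2) - H s)) ->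
  0 <= t <= 1 ->
  u t <= g (2 * A / dm) * (J (1/2) - l) / cm.
Proof.
  intros Hc Hp HJ HA H0 Hw Hdrop Ht.
  destruct (coeffs_pos _ _ Hc) as (Hcm & Hdm & HcM & HdM).
  pose proof (proj1 (proj2 HJ) (1/2) ltac:(lra)) as Hl.
  assert (Hg : 0 <= g (2 * A / dm)) by (apply g_nonneg, Rdiv_nonneg; lra).
  assert (Hb : forall s, 0 < s <= 1/2 -> u s <= g (2 * A / dm) * (J s - l) / cm).
  { intros s Hs.
    pose proof (half_bound c d u w H J l A 0 s Hc Hp HJ HA ltac:(lra) H0 Hw Hdrop Hs) as Hh.
    replace (2 * 0 / dm) with 0 in Hh by (field; lra).
    rewrite g0, Rmult_0_l, Rplus_0_l in Hh. exact Hh. }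
  destruct (Rle_dec (1/2) t) as [Ht2|Ht2].
  - apply Rle_trans with (u (1/2)); [|apply Hb; lra].
    apply (fall c d u w); auto.
  - destruct (Req_dec t 0) as [->|Hne].
    + apply Rle_trans with 0; auto. apply Rdiv_nonneg; auto. apply Rmult_le_pos; lra.
    + apply Rle_trans with (g (2 * A / dm) * (J t - l) / cm); [apply Hb; lra|].
      unfold Rdiv at 1 3. apply Rmult_le_compat_r; [left; apply Rinv_0_lt_compat; auto|].
      apply Rmult_le_compat_l; auto.
      enough (0 * (1/2 - t) <= J (1/2) - J t) by lra.
      apply deriv_lb_increment with (fun s => p1 (Rmax 0 (H (1/2) - H s))); [lra| |].
      * intros s Hs. apply HJ. lra.
      * intros s Hs. apply p1_nonneg, Rmax_l.
Qed.

End Profiles.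

(** * Shooting for the delayed problem *)


Lemma choice_fun (A B : Type) (P : A -> B -> Prop) :
  (forall x, exists y, P x y) -> exists f, forall x, P x (f x).
Proof.
  intros H. exists (fun x => proj1_sig (constructive_indefinite_description _ (H x))).
  intros x. apply proj2_sig.
Qed.

Lemma cont_bounded (f : R -> R) (a b : R) :
  a <= b -> continuity f -> exists K, 0 < K /\ forall t, a <= t <= b -> Rabs (f t) <= K.
Proof.
  intros Hab Hf.
  destruct (continuity_ab_maj f a b Hab) as [xM [HM _]]; [auto|].
  destruct (continuity_ab_min f a b Hab) as [xm [Hm _]]; [auto|].
  exists (1 + Rabs (f xM) + Rabs (f xm)).
  pose proof (Rabs_pos (f xM)). pose proof (Rabs_pos (f xm)).
  split; [lra|]. intros t Ht. specialize (HM t Ht). specialize (Hm t Ht).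
  apply Rabs_le. pose proof (Rle_abs (f xM)). pose proof (Rle_abs (- f xm)).
  rewrite Rabs_Ropp in *. lra.
Qed.

(** Continuity in the shooting parameter, uniform in time. The interval reaches back to -1 because a
    delay of at most 1 is subtracted from times in [0,1]. *)
Definition unif_cont_param (V : R -> R -> R) : Prop :=
  forall s0 eps, 0 < eps -> exists del, 0 < del /\
    forall s, Rabs (s - s0) < del -> forall t, -1 <= t <= 1 -> Rabs (V s t - V s0 t) < eps.

Lemma unif_cont_param_comp (V : R -> R -> R) (F : R -> R) :
  unif_cont_param V -> (forall s, continuity (V s)) -> continuity F ->
  unif_cont_param (fun s t => F (V s t)).
Proof.
  intros HV HVc HF s0 eps He.
  destruct (cont_bounded (V s0) (-1) 1 ltac:(lra) (HVc s0)) as [K [HK Hb]].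
  destruct (Heine_cor2 (f := F) (a := - (K + 1)) (b := K + 1) (fun x _ => HF x) (mkposreal eps He))
    as [eta Heta].
  simpl in Heta.
  destruct (HV s0 (Rmin eta 1)) as [del [Hdel H]].
  { apply Rmin_glb_lt; [apply cond_pos|lra]. }
  exists del; split; auto. intros s Hs t Ht.
  specialize (H s Hs t Ht). specialize (Hb t Ht).
  pose proof (Rmin_l eta 1). pose proof (Rmin_r eta 1).
  apply Rabs_le_between in Hb.
  assert (Hv : Rabs (V s t - V s0 t) < 1) by lra. apply Rabs_def2 in Hv.
  apply Heta; lra.
Qed.

Lemma unif_cont_param_mul (V : R -> R -> R) (k : R -> R) :
  unif_cont_param V -> continuity k -> unif_cont_param (fun s t => k t * V s t).
Proof.
  intros HV Hk s0 eps He.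
  destruct (cont_bounded k (-1) 1 ltac:(lra) Hk) as [K [HK Hb]].
  destruct (HV s0 (eps / K)) as [del [Hdel H]].
  { apply Rdiv_lt_0_compat; auto. }
  exists del; split; auto. intros s Hs t Ht.
  specialize (H s Hs t Ht). specialize (Hb t Ht).
  rewrite <- Rmult_minus_distr_l, Rabs_mult.
  apply Rle_lt_trans with (K * Rabs (V s t - V s0 t)).
  - apply Rmult_le_compat_r; auto using Rabs_pos.
  - replace eps with (K * (eps / K)) by (field; lra). apply Rmult_lt_compat_l; auto.
Qed.

Lemma unif_cont_param_primitive (V Y : R -> R -> R) :
  unif_cont_param V -> (forall s t, derivable_pt_lim (Y s) t (V s t)) ->
  continuity (fun s => Y s 0) -> unif_cont_param Y.
Proof.
  intros HV HY H0 s0 eps He.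
  destruct (HV s0 (eps / 2)) as [d1 [Hd1 H1]]; [lra|].
  destruct (proj1 (continuity_pt_eps _ s0) (H0 s0) (eps / 2)) as [d2 [Hd2 H2]]; [lra|].
  exists (Rmin d1 d2); split; [apply Rmin_glb_lt; auto|].
  intros s Hs t Ht.
  pose proof (Rmin_l d1 d2). pose proof (Rmin_r d1 d2).
  specialize (H2 s ltac:(lra)).
  pose proof (deriv_abs_increment (fun t => Y s t - Y s0 t) (fun t => V s t - V s0 t) (eps/2) 0 t)
    as Hi.
  assert (Hi' : Rabs (Y s t - Y s0 t - (Y s 0 - Y s0 0)) <= eps / 2 * Rabs (t - 0)).
  { apply Hi.
    - intros r _. apply derivable_pt_lim_minus; auto.
    - intros r Hr. left. apply H1; [lra|].
      revert Hr. unfold Rmin, Rmax; destruct Rle_dec; lra. }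
  rewrite Rminus_0_r in Hi'.
  assert (Ht1 : Rabs t <= 1) by (apply Rabs_le; lra).
  assert (Ht2 : eps / 2 * Rabs t <= eps / 2 * 1) by (apply Rmult_le_compat_l; lra).
  replace (Y s t - Y s0 t) with ((Y s t - Y s0 t - (Y s 0 - Y s0 0)) + (Y s 0 - Y s0 0)) by ring.
  eapply Rle_lt_trans; [apply Rabs_triang|]. lra.
Qed.

Lemma zero_deriv_agree (x y x' y' : R -> R) (T t : R) :
  0 <= T -> t <= T -> x 0 = y 0 ->
  (forall r, derivable_pt_lim x r (x' r)) -> (forall r, derivable_pt_lim y r (y' r)) ->
  (forall r, r <= T -> x' r = y' r) -> x t = y t.
Proof.
  intros HT Ht H0 Hx Hy He.
  pose proof (deriv_abs_increment (fun r => x r - y r) (fun r => x' r - y' r) 0 0 t) as H.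
  assert (H' : Rabs (x t - y t - (x 0 - y 0)) <= 0 * Rabs (t - 0)).
  { apply H.
    - intros r _. apply derivable_pt_lim_minus; auto.
    - intros r Hr. rewrite He, Rminus_diag, Rabs_R0; [lra|].
      revert Hr. unfold Rmin, Rmax; destruct Rle_dec; lra. }
  rewrite Rmult_0_l, H0 in H'. apply Rabs_le_between in H'. lra.
Qed.

Section Shooting.

Context (g c d k F : R -> R) (delta : R).
Context (g_cont : continuity g) (c_cont : continuity c) (d_cont : continuity d).
Context (c_pos : forall t, 0 < c t) (d_pos : forall t, 0 < d t).
Context (k_cont : continuity k) (k_zero : forall t, t <= 0 -> k t = 0).
Context (F_cont : continuity F).
Context (delta_range : 0 < delta <= 1).

(** [W] and then [U] arise from the input [V] by plain integration. A solution of the delayed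
    problem is a fixed point, in the sense that [V] and [U] agree up to time [1 - delta]. *)
Definition shot_step (V U W : R -> R -> R) : Prop :=
  (forall s t, derivable_pt_lim (U s) t (g (W s t / d t) / c t)) /\
  (forall s t, derivable_pt_lim (W s) t (- (k t * F (V s (t - delta))))) /\
  (forall s, U s 0 = 0) /\ (forall s, W s 0 = s) /\ unif_cont_param U.

Lemma shot_step_exists (V : R -> R -> R) :
  (forall s, continuity (V s)) -> unif_cont_param V -> exists U W, shot_step V U W.
Proof.
  intros HVc HV.
  assert (HFV : forall s, continuity (fun t => - (k t * F (V s (t - delta))))).
  { intros s. apply (continuity_opp (fun t => k t * F (V s (t - delta)))).
    apply (continuity_mult k (fun t => F (V s (t - delta)))); auto.
    apply (continuity_comp (fun t => V s (t - delta)) F); auto.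
    apply (continuity_comp (fun t => t - delta) (V s)); auto.
    apply (continuity_minus (fun t => t) (fun _ => delta));
      [apply continuity_idf|apply continuity_cst]. }
  destruct (choice_fun _ _ _ (fun s => primitive_of_continuous _ (HFV s))) as [W0 HW0].
  set (W := fun s t => s + W0 s t).
  assert (HWd : forall s t, derivable_pt_lim (W s) t (- (k t * F (V s (t - delta))))).
  { intros s t. unfold W.
    replace (- (k t * F (V s (t - delta)))) with (0 + - (k t * F (V s (t - delta)))) by ring.
    apply (derivable_pt_lim_plus (fun _ => s) (W0 s));
      [apply derivable_pt_lim_const|apply HW0]. }
  assert (HW0' : forall s, W s 0 = s).
  { intros s. unfold W. rewrite (proj1 (HW0 s)). ring. }
  assert (HWc : forall s, continuity (W s)).
  { intros s t. eapply derivable_pt_lim_cont, HWd. }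
  assert (HFVu : unif_cont_param (fun s t => - (k t * F (V s (t - delta))))).
  { intros s0 eps He.
    destruct (unif_cont_param_mul (fun s t => F (V s t)) (fun t => - k (t + delta))
      (unif_cont_param_comp V F HV HVc F_cont)) with (s0 := s0) (eps := eps)
      as [del [Hdel H]]; auto.
    { apply (continuity_opp (fun t => k (t + delta))).
      apply (continuity_comp (fun t => t + delta) k); auto.
      apply (continuity_plus (fun t => t) (fun _ => delta));
        [apply continuity_idf|apply continuity_cst]. }
    exists del; split; auto. intros s Hs t Ht.
    (* For [t <= 0] the time [t - delta] can leave [[-1, 1]], but [k] vanishes there. *)
    destruct (Rle_dec t 0) as [Ht0|Ht0].
    - rewrite k_zero by auto. rewrite !Rmult_0_l, Rminus_diag, Rabs_R0. auto.
    - specialize (H s Hs (t - delta) ltac:(lra)). cbv beta in H.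
      replace (t - delta + delta) with t in H by ring.
      rewrite <- !Ropp_mult_distr_l in H. exact H. }
  assert (HWu : unif_cont_param W).
  { eapply unif_cont_param_primitive; [exact HFVu|exact HWd|].
    intros s. apply continuity_pt_eps. intros eps He. exists eps; split; auto.
    intros y Hy. rewrite !HW0'. auto. }
  assert (Hdi : continuity (fun t => / d t)).
  { apply (continuity_inv d); auto. intros t; specialize (d_pos t); lra. }
  assert (Hci : continuity (fun t => / c t)).
  { apply (continuity_inv c); auto. intros t; specialize (c_pos t); lra. }
  assert (Hin : forall s, continuity (fun t => / d t * W s t)).
  { intros s. apply (continuity_mult (fun t => / d t) (W s)); auto. }
  assert (HGc : forall s, continuity (fun t => / c t * g (/ d t * W s t))).
  { intros s. apply (continuity_mult (fun t => / c t) (fun t => g (/ d t * W s t))); auto.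
    apply (continuity_comp (fun t => / d t * W s t) g); auto. }
  destruct (choice_fun _ _ _ (fun s => primitive_of_continuous _ (HGc s))) as [U HU].
  exists U, W. split; [|split; [|split; [|split]]]; auto.
  - intros s t. unfold Rdiv. rewrite (Rmult_comm _ (/ c t)), (Rmult_comm _ (/ d t)). apply HU.
  - intros s; apply HU.
  - apply unif_cont_param_primitive with (V := fun s t => / c t * g (/ d t * W s t)).
    + apply (unif_cont_param_mul (fun s t => g (/ d t * W s t)) (fun t => / c t)); auto.
      apply (unif_cont_param_comp (fun s t => / d t * W s t) g); auto.
      apply (unif_cont_param_mul W (fun t => / d t)); auto.
    + intros s t. apply HU.
    + intros s. apply continuity_pt_eps. intros eps He. exists 1; split; [lra|].
      intros y _. rewrite (proj1 (HU y)), (proj1 (HU s)), Rminus_diag, Rabs_R0. auto.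
Qed.

Lemma shot_step_cont (V U W : R -> R -> R) : shot_step V U W -> forall s, continuity (U s).
Proof. intros H s t. eapply derivable_pt_lim_cont, H. Qed.

Lemma shot_step_agree (V U W V' U' W' : R -> R -> R) (T : R) :
  shot_step V U W -> shot_step V' U' W' -> 0 <= T ->
  (forall s t, t <= T -> k t * F (V s (t - delta)) = k t * F (V' s (t - delta))) ->
  forall s t, t <= T -> U s t = U' s t.
Proof.
  intros (HU & HW & HU0 & HW0 & _) (HU' & HW' & HU0' & HW0' & _) HT He s t Ht.
  assert (HWW : forall t, t <= T -> W s t = W' s t).
  { intros r Hr. apply (zero_deriv_agree _ _ _ _ T r HT Hr) with (2 := HW s) (3 := HW' s).
    - rewrite HW0, HW0'; auto.
    - intros q Hq. cbv beta. rewrite He; auto. }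
  apply (zero_deriv_agree _ _ _ _ T t HT Ht) with (2 := HU s) (3 := HU' s).
  - rewrite HU0, HU0'; auto.
  - intros q Hq. cbv beta. rewrite HWW; auto.
Qed.

(* Each application of the delayed integral operator extends the interval on which
   its input and output agree by [delta]. *)
Lemma shot_iterate (j : nat) :
  exists V U W, shot_step V U W /\ forall s t, t <= INR j * delta -> V s t = U s t.
Proof.
  induction j as [|j (V & U & W & HS & He)].
  - destruct (shot_step_exists (fun _ _ => 0)) as (V & W & HS).
    { intros s; apply continuity_cst. }
    { intros s0 eps He. exists 1; split; [lra|]. intros. rewrite Rminus_diag, Rabs_R0; auto. }
    destruct (shot_step_exists V) as (U & W' & HS').
    { eapply shot_step_cont; eauto. }
    { apply HS. }
    exists V, U, W'. split; auto. intros s t Ht. simpl in Ht.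
    (* Up to time 0 the forcing vanishes whatever the input, so any two outputs agree there; this is
       the case [j = 0]. *)
    eapply shot_step_agree with (T := 0); eauto; try lra.
    intros s' t' Ht'. rewrite k_zero; auto. ring.
  - destruct (shot_step_exists U) as (U' & W' & HS').
    { eapply shot_step_cont; eauto. }
    { apply HS. }
    exists U, U', W'. split; auto.
    pose proof (pos_INR j) as Hj.
    assert (0 <= INR j * delta) by (apply Rmult_le_pos; lra).
    rewrite S_INR. intros s t Ht.
    eapply shot_step_agree with (T := (INR j + 1) * delta); eauto; try lra.
    intros s' t' Ht'. rewrite He; auto. lra.
Qed.

Lemma shots_exist :
  exists V U W, shot_step V U W /\ forall s t, t <= 1 -> V s (t - delta) = U s (t - delta).
Proof.
  destruct (archimed_cor1 delta (proj1 delta_range)) as (N & HN & HN0).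
  destruct (shot_iterate N) as (V & U & W & HS & He).
  exists V, U, W. split; auto. intros s t Ht. apply He.
  pose proof (lt_0_INR N HN0) as HNp.
  assert (1 <= INR N * delta); [|lra].
  replace 1 with (INR N * / INR N) by (field; lra). apply Rmult_le_compat_l; lra.
Qed.

(** Two maxima differ by no more than the uniform distance of the shots: each shot is evaluated at
    the maximum point of the other. *)
Lemma shot_max_cont (U : R -> R -> R) :
  unif_cont_param U -> (forall s, continuity (U s)) ->
  exists m : R -> R, continuity m /\
    forall s, (exists t, 0 <= t <= 1 /\ U s t = m s) /\ forall t, 0 <= t <= 1 -> U s t <= m s.
Proof.
  intros HU Hc.
  destruct (choice_fun R R (fun s y => (exists t, 0 <= t <= 1 /\ U s t = y) /\
    forall t, 0 <= t <= 1 -> U s t <= y)) as [m Hm].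
  { intros s. destruct (continuity_ab_maj (U s) 0 1) as [x [Hx Hx']]; [lra|intros; apply Hc|].
    exists (U s x). eauto. }
  exists m. split; auto. intros s. apply continuity_pt_eps. intros eps He.
  destruct (HU s eps He) as [del [Hdel H]]. exists del; split; auto.
  intros y Hy. destruct (Hm s) as [(t & Ht & Et) Hs], (Hm y) as [(t' & Ht' & Et') Hs'].
  pose proof (H y Hy t ltac:(lra)) as H1. pose proof (H y Hy t' ltac:(lra)) as H2.
  apply Rabs_def2 in H1. apply Rabs_def2 in H2.
  specialize (Hs t' Ht'). specialize (Hs' t Ht). apply Rabs_def1; lra.
Qed.

Lemma shot_end_cont (U : R -> R -> R) : unif_cont_param U -> continuity (fun s => U s 1).
Proof.
  intros HU s. apply continuity_pt_eps. intros eps He.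
  destruct (HU s eps He) as [del [Hdel H]]. exists del; split; auto.
  intros y Hy. apply H; auto; lra.
Qed.

End Shooting.

Lemma ivt_root (z : R -> R) (a b : R) :
  continuity z -> a <= b -> z a * z b <= 0 -> exists s, a <= s <= b /\ z s = 0.
Proof. intros Hz Hab H. destruct (IVT_cor z a b Hz Hab H) as [s [Hs E]]. eauto. Qed.

(* In both lemmas [m] and [e] stand for the maximum and the terminal value of a shot with
   initial slope [s]; shots whose maximum is [R0] overshoot, so the zero of the
   continuous [Rmin (e s) (+- (R0 - m s))] found by the intermediate value theorem
   can only be a zero of [e]. *)
Lemma shooting_below (m e : R -> R) (R0 r s1 : R) :
  continuity m -> continuity e -> 0 < r < R0 -> m 0 = 0 -> 0 < s1 -> R0 <= m s1 ->
  (forall s, 0 < s -> 0 < m s) ->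
  (forall s, m s = R0 -> e s < 0) -> (forall s, 0 < m s <= r -> 0 < e s) ->
  exists s, 0 < s /\ e s = 0 /\ r < m s <= R0.
Proof.
  intros Hm He Hr H0 Hs1 HR Hpos Hover Hunder.
  destruct (proj1 (continuity_pt_eps m 0) (Hm 0) r (proj1 Hr)) as [del [Hdel Hd]].
  set (s0 := Rmin (del / 2) s1).
  assert (Hs0 : 0 < s0) by (apply Rmin_glb_lt; lra).
  assert (Hs0' : s0 <= del / 2) by apply Rmin_l.
  assert (Hs01 : s0 <= s1) by apply Rmin_r.
  specialize (Hd s0). rewrite H0, !Rminus_0_r, (Rabs_right s0) in Hd by lra.
  specialize (Hd ltac:(lra)). apply Rabs_def2 in Hd.
  assert (Hms0 : 0 < m s0 <= r) by (specialize (Hpos s0 Hs0); lra).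
  destruct (ivt_root (fun s => Rmin (e s) (R0 - m s)) s0 s1) as [s [Hs Hz]]; auto.
  - intros s. apply continuity_pt_Rmin; auto. revert s. apply (continuity_minus (fun _ => R0) m); auto.
    apply continuity_cst.
  - assert (0 < Rmin (e s0) (R0 - m s0)) by (apply Rmin_glb_lt; [auto|lra]).
    assert (Rmin (e s1) (R0 - m s1) <= 0) by (pose proof (Rmin_r (e s1) (R0 - m s1)); lra).
    nra.
  - assert (Hs' : 0 < s) by lra.
    assert (E : e s = 0).
    { specialize (Hover s).
      revert Hz. unfold Rmin; destruct Rle_dec; intros; [auto|].
      assert (e s < 0) by (apply Hover; lra). lra. }
    exists s. split; auto. split; auto.
    pose proof (Rmin_r (e s) (R0 - m s)). split; [|lra].
    destruct (Rlt_dec r (m s)) as [|Hn]; auto.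
    specialize (Hpos s Hs'). specialize (Hunder s ltac:(lra)). lra.
Qed.

Lemma shooting_above (m e : R -> R) (R0 K s1 : R) :
  continuity m -> continuity e -> 0 < R0 < K -> m 0 = 0 -> 0 < s1 -> K <= m s1 ->
  (forall s, m s = R0 -> e s < 0) -> (forall s, K <= m s -> 0 < e s) ->
  exists s, 0 < s /\ e s = 0 /\ R0 <= m s < K.
Proof.
  intros Hm He Hr H0 Hs1 HR Hover Hunder.
  destruct (ivt_root (fun s => Rmin (e s) (m s - R0)) 0 s1) as [s [Hs Hz]]; [|lra| |].
  - intros s. apply continuity_pt_Rmin; auto. revert s. apply (continuity_minus m (fun _ => R0)); auto.
    apply continuity_cst.
  - assert (0 < Rmin (e s1) (m s1 - R0)) by (apply Rmin_glb_lt; [auto|lra]).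
    assert (Rmin (e 0) (m 0 - R0) <= 0) by (pose proof (Rmin_r (e 0) (m 0 - R0)); lra).
    nra.
  - assert (E : e s = 0).
    { specialize (Hover s).
      revert Hz. unfold Rmin; destruct Rle_dec; intros; [auto|].
      assert (e s < 0) by (apply Hover; lra). lra. }
    pose proof (Rmin_r (e s) (m s - R0)).
    exists s. split; [|split]; auto.
    + destruct (Req_dec s 0) as [->|]; lra.
    + split; [lra|]. destruct (Rlt_dec (m s) K) as [|Hn]; auto.
      specialize (Hunder s ltac:(lra)). lra.
Qed.

(** * Limits along a filter and primitives of the weight *)


Lemma filterlim_locally_eps (T : Type) (U : (T -> Prop) -> Prop) (a : T -> R) (l : R) :
  Filter U ->
  (filterlim a U (locally l) <-> forall eps, 0 < eps -> U (fun n => Rabs (a n - l) < eps)).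
Proof.
  intros HF. split.
  - intros H eps He. apply (H (fun y => Rabs (y - l) < eps)).
    exists (mkposreal eps He). intros y Hy. exact Hy.
  - intros H P [eps HP]. unfold filtermap.
    generalize (H eps (cond_pos eps)). apply filter_imp. intros n Hn. apply HP, Hn.
Qed.

Lemma filterlim_le_cst (T : Type) (U : (T -> Prop) -> Prop) (a : T -> R) (l B : R) :
  ProperFilter U -> filterlim a U (locally l) -> U (fun n => a n <= B) -> l <= B.
Proof.
  intros HF Hl Hb. apply Rle_plus_epsilon. intros eps He.
  pose proof (proj1 (filterlim_locally_eps T U a l _) Hl eps He) as H.
  destruct (filter_ex _ (filter_and _ _ H Hb)) as [n [Hn1 Hn2]].
  apply Rabs_def2 in Hn1. lra.
Qed.

Lemma filterlim_ge_cst (T : Type) (U : (T -> Prop) -> Prop) (a : T -> R) (l B : R) :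
  ProperFilter U -> filterlim a U (locally l) -> U (fun n => B <= a n) -> B <= l.
Proof.
  intros HF Hl Hb. apply Rle_plus_epsilon. intros eps He.
  pose proof (proj1 (filterlim_locally_eps T U a l _) Hl eps He) as H.
  destruct (filter_ex _ (filter_and _ _ H Hb)) as [n [Hn1 Hn2]].
  apply Rabs_def2 in Hn1. lra.
Qed.

Lemma filterlim_real_mult (T : Type) (G : (T -> Prop) -> Prop) (f f' : T -> R) (a b : R) :
  Filter G -> filterlim f G (locally a) -> filterlim f' G (locally b) ->
  filterlim (fun z => f z * f' z) G (locally (a * b)).
Proof.
  intros HG Hf Hf'. eapply filterlim_comp_2; [exact Hf|exact Hf'|].
  apply (filterlim_mult (K := R_AbsRing)).
Qed.

Lemma filterlim_real_cont (T : Type) (G : (T -> Prop) -> Prop) (f : T -> R) (k : R -> R) (a : R) :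
  filterlim f G (locally a) -> continuity_pt k a ->
  filterlim (fun z => k (f z)) G (locally (k a)).
Proof.
  intros Hf Hk. eapply filterlim_comp; [exact Hf|]. apply continuity_pt_filterlim, Hk.
Qed.

Lemma filterlim_real_minus (T : Type) (G : (T -> Prop) -> Prop) (f f' : T -> R) (a b : R) :
  Filter G -> filterlim f G (locally a) -> filterlim f' G (locally b) ->
  filterlim (fun z => f z - f' z) G (locally (a - b)).
Proof.
  intros HG Hf Hf'.
  apply (filterlim_comp_2 (G := locally a) (H := locally (- b)) f (fun z => - f' z) Rplus).
  - exact Hf.
  - apply (filterlim_real_cont _ _ f' Ropp); auto. apply (continuity_opp (fun a => a)), continuity_idf.
  - apply (filterlim_plus (V := R_NormedModule)).
Qed.

(** A common Lipschitz constant upgrades the limit at the single time [t] to a limit in index and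
    time together, which tolerates evaluation points that move with [n], such as delayed times. *)
Lemma equilipschitz_joint_limit (U : (nat -> Prop) -> Prop) (x : nat -> R -> R) (t l L rho : R) :
  Filter U -> 0 < rho -> 0 <= L ->
  (forall n s, Rabs (s - t) < rho -> Rabs (x n s - x n t) <= L * Rabs (s - t)) ->
  filterlim (fun n => x n t) U (locally l) ->
  filterlim (fun z => x (fst z) (snd z)) (filter_prod U (locally t)) (locally l).
Proof.
  intros HF Hr HL Hlip Hl.
  apply filterlim_locally_eps; [apply filter_prod_filter; auto; apply locally_filter|].
  intros eps He.
  assert (Hd : 0 < Rmin rho (eps / (2 * (L + 1)))).
  { apply Rmin_glb_lt; auto. apply Rdiv_lt_0_compat; lra. }
  apply Filter_prod with (fun n => Rabs (x n t - l) < eps / 2)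
    (fun s => Rabs (s - t) < Rmin rho (eps / (2 * (L + 1)))).
  - apply (proj1 (filterlim_locally_eps nat U _ l HF) Hl). lra.
  - exists (mkposreal _ Hd). intros y Hy; exact Hy.
  - intros n s Hn Hs. simpl.
    pose proof (Rmin_l rho (eps / (2 * (L + 1)))).
    pose proof (Rmin_r rho (eps / (2 * (L + 1)))).
    specialize (Hlip n s ltac:(lra)).
    assert (L * Rabs (s - t) <= (L + 1) * (eps / (2 * (L + 1)))).
    { apply Rmult_le_compat; try lra. apply Rabs_pos. }
    replace ((L + 1) * (eps / (2 * (L + 1)))) with (eps / 2) in * by (field; lra).
    replace (x n s - l) with ((x n s - x n t) + (x n t - l)) by ring.
    eapply Rle_lt_trans; [apply Rabs_triang|]. lra.
Qed.

(** Joint convergence of the derivatives replaces locally uniform convergence: for [U]-most [n] and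
    all [s] near [t], [y n s] is within [eps / 2] of [l], and the mean value theorem applies to
    [x n s - l * s]. *)
Lemma joint_limit_deriv (U : (nat -> Prop) -> Prop) (x y : nat -> R -> R) (X : R -> R) (t l rho : R) :
  ProperFilter U -> 0 < rho ->
  (forall n s, Rabs (s - t) < rho -> derivable_pt_lim (x n) s (y n s)) ->
  (forall s, Rabs (s - t) < rho -> filterlim (fun n => x n s) U (locally (X s))) ->
  filterlim (fun z => y (fst z) (snd z)) (filter_prod U (locally t)) (locally l) ->
  derivable_pt_lim X t l.
Proof.
  intros HF Hr Hd HX Hy eps He.
  assert (HFp : Filter (filter_prod U (locally t))).
  { apply filter_prod_filter; [apply HF|apply locally_filter]. }
  pose proof (proj1 (filterlim_locally_eps _ _ _ l HFp) Hy (eps / 2) ltac:(lra)) as HP.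
  destruct HP as [P Q HP [del HQ] HPQ].
  assert (Hm : 0 < Rmin del rho) by (apply Rmin_glb_lt; auto; apply cond_pos).
  exists (mkposreal _ Hm). intros h Hh0 Hh. simpl in Hh.
  pose proof (Rmin_l del rho). pose proof (Rmin_r del rho).
  assert (Hh' : 0 < Rabs h) by (apply Rabs_pos_lt; auto).
  (* Passing from [X] to [x n] at the two end points costs at most [2 * eta], a quarter of
     [eps * Rabs h]; the mean value estimate takes half of it. *)
  set (eta := eps * Rabs h / 8).
  assert (Heta : 0 < eta) by (apply Rdiv_lt_0_compat; [apply Rmult_lt_0_compat; auto|lra]).
  pose proof (proj1 (filterlim_locally_eps _ _ _ _ filter_filter)
    (HX (t + h) ltac:(replace (t + h - t) with h by ring; lra)) eta Heta) as H1.
  pose proof (proj1 (filterlim_locally_eps _ _ _ _ filter_filter)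
    (HX t ltac:(rewrite Rminus_diag, Rabs_R0; lra)) eta Heta) as H2.
  (* One index is enough, and it may depend on [h], because the estimate to be shown for [X] no
     longer involves [n]. *)
  destruct (filter_ex _ (filter_and _ _ HP (filter_and _ _ H1 H2))) as [n (Hn & Hn1 & Hn2)].
  assert (Hinc : Rabs (x n (t + h) - l * (t + h) - (x n t - l * t)) <= eps / 2 * Rabs (t + h - t)).
  { assert (Hin : forall s, Rmin t (t + h) <= s <= Rmax t (t + h) -> Rabs (s - t) <= Rabs h).
    { intros s. unfold Rmin, Rmax, Rabs; repeat destruct Rle_dec; repeat destruct Rcase_abs; lra. }
    apply (deriv_abs_increment (fun s => x n s - l * s) (fun s => y n s - l)).
    - intros s Hs. specialize (Hin s Hs).
      apply (derivable_pt_lim_minus (x n) (fun s => l * s)).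
      + apply Hd; lra.
      + apply derivable_pt_lim_linear.
    - intros s Hs. specialize (Hin s Hs). left. apply (HPQ n s); auto.
      apply HQ. change (Rabs (s - t) < del). lra. }
  replace (t + h - t) with h in Hinc by ring.
  assert (Hfin : Rabs (X (t + h) - X t - l * h) < eps * Rabs h).
  { replace (X (t + h) - X t - l * h) with
      ((x n (t + h) - l * (t + h) - (x n t - l * t)) +
       (- (x n (t + h) - X (t + h)) + (x n t - X t))) by ring.
    eapply Rle_lt_trans; [apply Rabs_triang|].
    assert (Rabs (- (x n (t + h) - X (t + h)) + (x n t - X t)) <= 2 * eta).
    { eapply Rle_trans; [apply Rabs_triang|]. rewrite Rabs_Ropp. lra. }
    unfold eta in *. lra. }
  replace ((X (t + h) - X t) / h - l) with ((X (t + h) - X t - l * h) / h) by (field; auto).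
  unfold Rdiv. rewrite Rabs_mult, Rabs_inv.
  replace eps with (eps * Rabs h * / Rabs h) by (field; lra).
  apply Rmult_lt_compat_r; auto. apply Rinv_0_lt_compat; auto.
Qed.

Lemma increasing_inf (J P : R -> R) (B : R) :
  (forall s, 0 < s < 1 -> derivable_pt_lim J s (P s)) -> (forall s, 0 < s < 1 -> 0 <= P s) ->
  (forall s, 0 < s < 1/2 -> - B <= J s) ->
  exists l, (forall s, 0 < s < 1 -> l <= J s) /\
    forall eps, 0 < eps -> exists del, 0 < del /\ forall s, 0 < s < del -> s < 1 -> J s < l + eps.
Proof.
  intros HJ HP HB.
  assert (Hmono : forall a b, 0 < a -> a <= b -> b < 1 -> J a <= J b).
  { intros a b Ha Hab Hb.
    enough (0 * (b - a) <= J b - J a) by lra.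
    apply deriv_lb_increment with P; auto; intros s Hs; [apply HJ|apply HP]; lra. }
  destruct (completeness (fun y => exists s, 0 < s < 1 /\ y = - J s)) as [l [Hub Hlub]].
  - exists B. intros y (s & Hs & ->).
    destruct (Rlt_dec s (1/2)) as [H|H].
    + specialize (HB s ltac:(lra)). lra.
    + specialize (HB (1/4) ltac:(lra)). specialize (Hmono (1/4) s ltac:(lra) ltac:(lra) ltac:(lra)).
      lra.
  - exists (- J (1/2)), (1/2). split; [lra|auto].
  - exists (- l). split.
    + intros s Hs. specialize (Hub (- J s)). enough (- J s <= l) by lra. apply Hub. eauto.
    + intros eps He.
      assert (Hs : exists s, 0 < s < 1 /\ J s < - l + eps).
      { apply NNPP. intros Hn. enough (l <= l - eps) by lra. apply Hlub.
        intros y (s & Hs & ->). destruct (Rle_dec (- J s) (l - eps)); auto.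
        exfalso; apply Hn. exists s. split; auto. lra. }
      destruct Hs as (s & Hs & HJs). exists s. split; [lra|].
      intros r Hr _. specialize (Hmono r s ltac:(lra) ltac:(lra) ltac:(lra)). lra.
Qed.

(** The hypothesis bounds only truncated integrals, but of nonnegative integrands: the primitive is
    nondecreasing and bounded below, so [increasing_inf] supplies its limit at the endpoint. The
    integrand has a primitive because [inverse_continuous] makes [inv_pos psi1] continuous. *)
Lemma half_primitives_exist (psi1 h : R -> R) :
  incr_homeo_pos psi1 -> cont_on O01 h -> (forall t, 0 < t < 1 -> 0 <= h t) ->
  h_integrability psi1 h ->
  exists H, (forall s, 0 < s < 1 -> derivable_pt_lim H s (h s)) /\
    (exists J l, half_primitive (inv_pos psi1) H J l) /\
    (exists J l, half_primitive (inv_pos psi1) (fun s => - H (1 - s)) J l).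
Proof.
  intros (Hinc & Hc & Hnn & Hsurj) Hh Hh0 (B & HB1 & HB2).
  set (p1 := inv_pos psi1).
  assert (Hp1 : forall y, 0 <= y -> 0 <= p1 y /\ psi1 (p1 y) = y).
  { intros y Hy. unfold p1, inv_pos. apply epsilon_spec, Hsurj, Hy. }
  assert (Hp1c : continuity (fun x => p1 (Rmax 0 x))).
  { apply (cont_on_retract Defs.nonneg p1 (fun x => Rmax 0 x)).
    - apply inverse_continuous with psi1; unfold Defs.nonneg; auto.
      intros; lra.
    - intros x. apply continuity_pt_Rmax; [apply continuity_cst|apply continuity_idf].
    - intros x. apply Rmax_l. }
  set (H := fun s => Coquelicot.RInt.RInt h (1/2) s).
  pose proof (primitive_on_open h (fun t Ht => cont_on_open h t Hh Ht)) as HH.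
  assert (HHd : forall s, 0 < s < 1 -> derivable_pt_lim H s (h s)) by (intros s Hs; apply HH, Hs).
  assert (HHm : forall a b, 0 < a -> a <= b -> b < 1 -> H a <= H b).
  { intros a b Ha Hab Hb. enough (0 * (b - a) <= H b - H a) by lra.
    apply deriv_lb_increment with h; auto; intros s Hs; [apply HHd|apply Hh0]; lra. }
  assert (HH2 : H (1/2) = 0) by apply (RInt_point (V := R_CompleteNormedModule)).
  assert (HP : forall (k : R -> R), continuity k -> forall t, 0 < t < 1 ->
    continuity_pt (fun s => p1 (Rmax 0 (k (H s)))) t).
  { intros k Hk t Ht.
    apply (continuity_pt_comp H (fun y => p1 (Rmax 0 (k y)))).
    - eapply derivable_pt_lim_cont, HHd, Ht.
    - apply (continuity_comp k (fun y => p1 (Rmax 0 y))); auto. }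
  exists H. split; auto. split.
  - pose proof (primitive_on_open _ (HP (fun y => H (1/2) - y)
      (continuity_minus (fun _ => H (1/2)) (fun y => y) (continuity_cst _) continuity_idf))) as HJ.
    set (P := fun s => p1 (Rmax 0 (H (1/2) - H s))) in *.
    destruct (increasing_inf (fun s => Coquelicot.RInt.RInt P (1/2) s) P B) as (l & Hl1 & Hl2).
    + intros s Hs; apply HJ, Hs.
    + intros s Hs; apply Hp1, Rmax_l.
    + intros s Hs. specialize (HB1 s Hs).
      (* Left of 1/2 the difference [H (1/2) - H x] is nonnegative, so [Rmax 0] is transparent and
         [P] is the integrand of the hypothesis. *)
      assert (Hexts : forall x, Rmin s (1/2) < x < Rmax s (1/2) ->
        P x = inv_pos psi1 (Defs.RInt h x (1/2))).
      { intros x. rewrite Rmin_left, Rmax_right by lra. intros Hx. unfold P. f_equal.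
        rewrite Defs_RInt_eq by (apply ex_RInt_swap, HH; lra).
        rewrite <- (opp_RInt_swap (V := R_CompleteNormedModule)) by (apply HH; lra).
        change (opp (Coquelicot.RInt.RInt h (1/2) x)) with (- H x).
        specialize (HHm x (1/2) ltac:(lra) ltac:(lra) ltac:(lra)).
        rewrite Rmax_right by lra. rewrite HH2. unfold p1; f_equal; ring. }
      assert (HexP : ex_RInt P s (1/2)) by (apply ex_RInt_swap, HJ; lra).
      rewrite Defs_RInt_eq in HB1.
      * rewrite <- (RInt_ext (V := R_CompleteNormedModule) _ _ _ _ Hexts) in HB1.
        rewrite <- (opp_RInt_swap (V := R_CompleteNormedModule)) by auto.
        change (- B <= - Coquelicot.RInt.RInt P s (1/2)). lra.
      * apply (ex_RInt_ext P); auto.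
    + exists (fun s => Coquelicot.RInt.RInt P (1/2) s), l.
      split; [|split]; auto. intros s Hs; apply HJ, Hs.
  - pose proof (primitive_on_open _ (HP (fun y => y - H (1/2))
      (continuity_minus (fun y => y) (fun _ => H (1/2)) continuity_idf (continuity_cst _)))) as HJ.
    set (P := fun s => p1 (Rmax 0 (H s - H (1/2)))) in *.
    (* The minus sign cancels the one produced by reflecting time, so that [J] is again
       nondecreasing. *)
    set (J := fun s => - Coquelicot.RInt.RInt P (1/2) (1 - s)).
    assert (HJd : forall s, 0 < s < 1 -> derivable_pt_lim J s (P (1 - s))).
    { intros s Hs. replace (P (1 - s)) with (- - P (1 - s)) by ring.
      apply (derivable_pt_lim_opp (fun s => Coquelicot.RInt.RInt P (1/2) (1 - s))).
      apply derivable_pt_lim_reflect, HJ. lra. }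
    destruct (increasing_inf J (fun s => P (1 - s)) B) as (l & Hl1 & Hl2); auto.
    + intros s Hs; apply Hp1, Rmax_l.
    + intros s Hs. specialize (HB2 s Hs).
      assert (Hexts : forall x, Rmin (1/2) (1 - s) < x < Rmax (1/2) (1 - s) ->
        P x = inv_pos psi1 (Defs.RInt h (1/2) x)).
      { intros x. rewrite Rmin_left, Rmax_right by lra. intros Hx. unfold P. f_equal.
        rewrite Defs_RInt_eq by (apply HH; lra).
        change (Coquelicot.RInt.RInt h (1/2) x) with (H x).
        specialize (HHm (1/2) x ltac:(lra) ltac:(lra) ltac:(lra)).
        rewrite Rmax_right by lra. rewrite HH2. unfold p1; f_equal; ring. }
      rewrite Defs_RInt_eq in HB2.
      * rewrite <- (RInt_ext (V := R_CompleteNormedModule) _ _ _ _ Hexts) in HB2.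
        unfold J. lra.
      * apply (ex_RInt_ext P); auto. apply HJ; lra.
    + exists J, l. split; [|split]; auto. intros s Hs. cbv beta.
      replace (- H (1 - 1/2) - - H (1 - s)) with (H (1 - s) - H (1/2)).
      * apply HJd, Hs.
      * replace (1 - 1/2) with (1/2) by field. ring.
Qed.

(** * Delayed solutions and their limit *)


Section Problem.

Context (phi g p1 c d h F : R -> R) (cm cM dm dM : R).
Context (g_phi : forall x, g (phi x) = x) (phi_g : forall y, phi (g y) = y).
Context (g_odd : forall x, g (- x) = - g x).
Context (g_incr : forall x y, x < y -> g x < g y).
Context (g_cont : continuity g).
Context (p1_nonneg : forall y, 0 <= y -> 0 <= p1 y).
Context (g_mul : forall x y, 0 <= x -> 0 <= y -> g (x * y) <= g x * p1 y).
Context (c_cont : continuity c) (d_cont : continuity d).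
Context (cd_bounds : coeffs cm cM dm dM c d).
Context (h_cont : forall t, 0 < t < 1 -> continuity_pt h t).
Context (h_nonneg : forall t, 0 < t < 1 -> 0 <= h t).
Context (h_nonzero : exists t, 0 < t < 1 /\ h t <> 0).
Context (F_cont : continuity F) (F_nonneg : forall x, 0 <= F x).
Context (F_neg : forall x, x <= 0 -> F x = F 0) (F_pos : forall x, 0 < x -> 0 < F x).
Context (H Jl Jr : R -> R) (ll lr : R).
Context (H_deriv : forall s, 0 < s < 1 -> derivable_pt_lim H s (h s)).
Context (half_l : half_primitive p1 H Jl ll).
Context (half_r : half_primitive p1 (fun s => - H (1 - s)) Jr lr).

Lemma phi_incr (x y : R) : x < y -> phi x < phi y.
Proof.
  intros Hxy. destruct (Rlt_dec (phi x) (phi y)) as [|Hn]; auto.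
  pose proof (g_le g g_incr (phi y) (phi x) ltac:(lra)) as Hg. rewrite !g_phi in Hg. lra.
Qed.

Lemma F_bounded (m : R) : exists A, 0 < A /\ forall x, x <= m -> F x <= A.
Proof.
  destruct (cont_bounded F 0 (Rmax 0 m) (Rmax_l 0 m) F_cont) as (A & HA & Hb).
  exists A. split; auto. intros x Hx. destruct (Rle_dec 0 x) as [H0|H0].
  - specialize (Hb x (conj H0 (Rle_trans _ _ _ Hx (Rmax_r 0 m)))).
    pose proof (Rle_abs (F x)). lra.
  - rewrite F_neg by lra. specialize (Hb 0 ltac:(split; [lra|apply Rmax_l])).
    pose proof (Rle_abs (F 0)). lra.
Qed.

(* Agrees with [h] near any given interior point for large [n], and vanishes outside (0,1),
   where [h] is unconstrained. *)
Definition cutoff (n : nat) (t : R) : R := Rmax 0 (Rmin (h t) (INR (S n) * (t * (1 - t)))).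

Lemma cutoff_le_parabola (n : nat) (t : R) :
  0 <= cutoff n t <= Rmax 0 (INR (S n) * (t * (1 - t))).
Proof.
  unfold cutoff. split; [apply Rmax_l|].
  apply Rmax_case; [apply Rmax_l|].
  eapply Rle_trans; [apply Rmin_r|apply Rmax_r].
Qed.

Lemma cutoff_le_h (n : nat) (t : R) : 0 < t < 1 -> cutoff n t <= h t.
Proof. intros Ht. unfold cutoff. apply Rmax_lub; [auto|apply Rmin_l]. Qed.

Lemma cutoff_zero (n : nat) (t : R) : t <= 0 -> cutoff n t = 0.
Proof.
  intros Ht. pose proof (cutoff_le_parabola n t) as Hc.
  rewrite Rmax_left in Hc; [lra|].
  pose proof (pos_INR (S n)). assert (t * (1 - t) <= 0) by nra. nra.
Qed.

(** Off (0,1) nothing is known about [h]; there the cutoff is squeezed between 0 and the positive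
    part of a continuous parabola that is nonpositive. *)
Lemma cutoff_cont (n : nat) : continuity (cutoff n).
Proof.
  assert (Hp : continuity (fun t => INR (S n) * (t * (1 - t)))).
  { apply (continuity_mult (fun _ => INR (S n)) (fun t => t * (1 - t))); [apply continuity_cst|].
    apply (continuity_mult (fun t => t) (fun t => 1 - t)); [apply continuity_idf|].
    apply (continuity_minus (fun _ => 1) (fun t => t)); [apply continuity_cst|apply continuity_idf]. }
  intros t. destruct (classic (0 < t < 1)) as [Ht|Ht].
  - apply continuity_pt_Rmax; [apply continuity_cst|]. apply continuity_pt_Rmin; auto.
  - apply continuity_pt_eps. intros eps He.
    destruct (proj1 (continuity_pt_eps _ t) (Hp t) eps He) as (del & Hdel & Hd).
    exists del. split; auto. intros y Hy. specialize (Hd y Hy). apply Rabs_def2 in Hd.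
    assert (Hneg : INR (S n) * (t * (1 - t)) <= 0).
    { pose proof (pos_INR (S n)). assert (t * (1 - t) <= 0) by nra. nra. }
    pose proof (cutoff_le_parabola n t) as H1. pose proof (cutoff_le_parabola n y) as H2.
    rewrite Rmax_left in H1 by auto.
    assert (Rmax 0 (INR (S n) * (y * (1 - y))) < eps) by (apply Rmax_lub_lt; lra).
    apply Rabs_def1; lra.
Qed.

(** The flux is differentiable on the whole line, but its derivative is tied to [u] only up to time
    1, the range in which input and output of the last integration step are known to agree. *)
Definition delayed_solution (lam : R) (n : nat) (u w : R -> R) : Prop :=
  profile g c d u w /\ u 0 = 0 /\
  exists q, (forall t, derivable_pt_lim w t (- q t)) /\
    forall t, t <= 1 -> q t = lam * cutoff n t * F (u (t - / INR (S n))).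

Lemma delay_range (n : nat) : 0 < / INR (S n) <= 1.
Proof.
  assert (1 <= INR (S n)) by (rewrite S_INR; pose proof (pos_INR n); lra).
  split; [apply Rinv_0_lt_compat; lra|].
  rewrite <- Rinv_1. apply Rinv_le_contravar; lra.
Qed.

Lemma delayed_solutions_exist (lam : R) (n : nat) :
  0 < lam ->
  exists U W : R -> R -> R,
    (forall s, delayed_solution lam n (U s) (W s) /\ W s 0 = s) /\ unif_cont_param U.
Proof.
  intros Hlam.
  assert (Hpos : forall t, 0 < c t /\ 0 < d t).
  { intros t. destruct cd_bounds as (H1 & H2 & H3). specialize (H3 t). lra. }
  destruct (shots_exist g c d (fun t => lam * cutoff n t) F (/ INR (S n)))
    as (V & U & W & (HU & HW & HU0 & HW0 & HUC) & He); auto.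
  - intros t; apply Hpos.
  - intros t; apply Hpos.
  - apply (continuity_mult (fun _ => lam) (cutoff n)); [apply continuity_cst|apply cutoff_cont].
  - intros t Ht. rewrite cutoff_zero by auto. ring.
  - apply delay_range.
  - exists U, W. split; auto. intros s. split; [|auto]. split; [split|split]; auto.
    + intros a b Hab. enough (W s b - W s a <= 0 * (b - a)) by lra.
      eapply deriv_ub_increment; [auto|intros t _; apply HW|]. intros t _. cbv beta.
      pose proof (proj1 (cutoff_le_parabola n t)).
      pose proof (F_nonneg (V s (t - / INR (S n)))).
      assert (0 <= lam * cutoff n t * F (V s (t - / INR (S n)))); [|lra].
      repeat apply Rmult_le_pos; lra.
    + exists (fun t => lam * cutoff n t * F (V s (t - / INR (S n)))).
      split; [apply HW|]. intros t Ht. rewrite He; auto.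
Qed.

Lemma initial_flux_pos (lam : R) (n : nat) (u w : R -> R) (t : R) :
  delayed_solution lam n u w -> 0 <= t -> 0 < u t -> 0 < w 0.
Proof.
  intros (Hp & Hu0 & _) Ht Hut. destruct (Rlt_dec 0 (w 0)) as [|Hn]; auto.
  pose proof (fall g g_odd g_incr cm cM dm dM c d u w 0 t cd_bounds Hp Ht ltac:(lra)). lra.
Qed.

Lemma initially_increasing (lam : R) (n : nat) (u w : R -> R) :
  delayed_solution lam n u w -> 0 < w 0 -> exists t, 0 <= t <= 1 /\ 0 < u t.
Proof.
  intros (Hp & Hu0 & q & Hw & _) Hw0.
  pose proof (derivable_pt_lim_cont _ _ _ (Hw 0)) as Hc.
  destruct (proj1 (continuity_pt_eps _ _) Hc (w 0 / 2) ltac:(lra)) as (del & Hdel & Hd).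
  set (t := Rmin (del / 2) 1).
  assert (Ht : 0 < t) by (apply Rmin_glb_lt; lra).
  assert (Ht1 : t <= 1) by apply Rmin_r. assert (Ht2 : t <= del / 2) by apply Rmin_l.
  exists t. split; [lra|].
  specialize (Hd t ltac:(rewrite Rminus_0_r, Rabs_right; lra)). apply Rabs_def2 in Hd.
  pose proof (rise_lower g g_odd g_incr cm cM dm dM c d u w 0 t cd_bounds Hp ltac:(lra) ltac:(lra)).
  destruct (coeffs_pos _ _ _ _ _ _ cd_bounds) as (Hcm & Hdm & HcM & HdM).
  assert (0 < g (w t / dM)).
  { rewrite <- (g0 g g_odd). apply g_incr, Rdiv_lt_0_compat; lra. }
  assert (0 < g (w t / dM) / cM * (t - 0)); [|lra].
  apply Rmult_lt_0_compat; [apply Rdiv_lt_0_compat; lra|lra].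
Qed.

(** Bounding the cutoff by [h] makes both estimates independent of [n]. At a negative delayed time
    [u] is at most [u 0 = 0], since the flux there is at least [w 0 >= 0], so the bound on [F] still
    applies. *)
Lemma flux_drop_upper (lam : R) (n : nat) (u w : R -> R) (m A : R) :
  0 < lam -> delayed_solution lam n u w -> 0 <= w 0 -> 0 <= m ->
  (forall t, 0 <= t <= 1 -> u t <= m) -> (forall x, x <= m -> F x <= A) ->
  (forall s t, 0 < s -> s <= t -> t < 1 -> w s - w t <= lam * A * (H t - H s)) /\
  (forall q t, derivable_pt_lim w t (- q) -> 0 < t < 1 -> 0 <= q <= lam * A * h t).
Proof.
  intros Hlam (Hp & Hu0 & q & Hw & Hq) Hw0 Hm Hu HF.
  assert (Hdel : forall t, 0 < t < 1 -> 0 <= q t <= lam * A * h t).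
  { intros t Ht. rewrite Hq by lra.
    set (tau := t - / INR (S n)). pose proof (delay_range n) as Hr.
    assert (Hut : u tau <= m).
    { destruct (Rle_dec 0 tau) as [H0|H0].
      - apply Hu. unfold tau in *. lra.
      - pose proof (rise_lower g g_odd g_incr cm cM dm dM c d u w tau 0 cd_bounds Hp ltac:(lra) Hw0)
          as Hri.
        destruct (coeffs_pos _ _ _ _ _ _ cd_bounds) as (Hcm & Hdm & HcM & HdM).
        assert (0 <= g (w 0 / dM) / cM * (0 - tau)); [|lra].
        apply Rmult_le_pos; [|lra]. apply Rdiv_nonneg; [|lra].
        apply (g_nonneg g g_odd g_incr), Rdiv_nonneg; lra. }
    pose proof (HF _ Hut). pose proof (F_nonneg (u tau)).
    pose proof (cutoff_le_h n t Ht). pose proof (proj1 (cutoff_le_parabola n t)).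
    split; [repeat apply Rmult_le_pos; lra|].
    rewrite !Rmult_assoc. apply Rmult_le_compat_l; [lra|]. rewrite Rmult_comm.
    apply Rmult_le_compat; lra. }
  split.
  - intros s t Hs Hst Ht.
    enough (- w t - - w s <= lam * A * H t - lam * A * H s) by lra.
    apply (deriv_le_increment (fun t => - w t) (fun t => - - q t) (fun t => lam * A * H t)
      (fun t => lam * A * h t)); auto.
    + intros r _. apply (derivable_pt_lim_opp w), Hw.
    + intros r Hr. apply (derivable_pt_lim_scal H), H_deriv. lra.
    + intros r Hr. specialize (Hdel r ltac:(lra)). lra.
  - intros q' t Hq' Ht. rewrite <- (Ropp_involutive q').
    rewrite (uniqueness_limite _ _ _ _ Hq' (Hw t)), Ropp_involutive. auto.
Qed.

Lemma reflected_drop (w : R -> R) (A s : R) :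
  (forall s t, 0 < s -> s <= t -> t < 1 -> w s - w t <= A * (H t - H s)) -> 0 < s <= 1/2 ->
  - w (1 - s) - - w (1 - 1/2) <= A * (- H (1 - 1/2) - - H (1 - s)).
Proof. intros Hd Hs. specialize (Hd (1 - 1/2) (1 - s)). lra. Qed.

(** The sign of the flux at 1/2 decides from which end [u] is controlled. If it is positive, the
    reflected profile has a negative one, and [u 1 <= 0] takes over the role of [u 0 = 0]. *)
Lemma compression (lam : R) (n : nat) (u w : R -> R) (m A B t : R) :
  0 < lam -> 0 <= A -> delayed_solution lam n u w -> 0 <= w 0 -> 0 <= m ->
  (forall t, 0 <= t <= 1 -> u t <= m) -> (forall x, x <= m -> F x <= A) ->
  Jl (1/2) - ll <= B -> Jr (1/2) - lr <= B -> u 1 <= 0 -> 0 <= t <= 1 ->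
  u t <= g (2 * (lam * A) / dm) * B / cm.
Proof.
  intros Hlam HA Hds Hw0 Hm Hu HF HBl HBr Hu1 Ht.
  destruct (flux_drop_upper lam n u w m A Hlam Hds Hw0 Hm Hu HF) as [Hd _].
  destruct Hds as (Hp & Hu0 & _).
  destruct (coeffs_pos _ _ _ _ _ _ cd_bounds) as (Hcm & Hdm & HcM & HdM).
  assert (HlA : 0 <= lam * A) by (apply Rmult_le_pos; lra).
  assert (Hg : 0 <= g (2 * (lam * A) / dm)).
  { apply (g_nonneg g g_odd g_incr), Rdiv_nonneg; lra. }
  assert (Hmon : forall b, b <= B ->
    g (2 * (lam * A) / dm) * b / cm <= g (2 * (lam * A) / dm) * B / cm).
  { intros b Hb. unfold Rdiv at 1 3. apply Rmult_le_compat_r; [left; apply Rinv_0_lt_compat; auto|].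
    apply Rmult_le_compat_l; auto. }
  destruct (Rle_dec (w (1/2)) 0) as [Hw|Hw].
  - eapply Rle_trans; [|apply Hmon, HBl].
    apply (compression_left g p1 g_odd g_incr p1_nonneg g_mul cm cM dm dM c d u w H); auto; try lra.
    intros s Hs. apply Hd; lra.
  - eapply Rle_trans; [|apply Hmon, HBr].
    replace t with (1 - (1 - t)) by ring.
    apply (compression_left g p1 g_odd g_incr p1_nonneg g_mul cm cM dm dM
      (fun t => c (1 - t)) (fun t => d (1 - t)) (fun t => u (1 - t)) (fun t => - w (1 - t))
      (fun s => - H (1 - s)) Jr lr (lam * A) (1 - t)); auto; try lra.
    + apply coeffs_reflect, cd_bounds.
    + apply profile_reflect; auto.
    + rewrite Rminus_0_r. auto.
    + replace (1 - 1/2) with (1/2) by field. lra.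
    + intros s Hs. apply reflected_drop; auto.
Qed.

(** * Overshooting and undershooting shots *)

Lemma h_positive_interval :
  exists p q h0, 0 < p /\ p < q /\ q < 1 /\ 0 < h0 /\
    forall n t, p <= t <= q -> h0 <= cutoff n t.
Proof.
  destruct h_nonzero as (t0 & Ht0 & Hne).
  assert (Hh0 : 0 < h t0) by (specialize (h_nonneg t0 Ht0); lra).
  destruct (proj1 (continuity_pt_eps h t0) (h_cont t0 Ht0) (h t0 / 2) ltac:(lra))
    as (del & Hdel & Hd).
  set (e := Rmin (del / 2) (Rmin (t0 / 2) ((1 - t0) / 2))).
  assert (He : 0 < e) by (repeat apply Rmin_glb_lt; lra).
  pose proof (Rmin_l (del / 2) (Rmin (t0 / 2) ((1 - t0) / 2))) as H1. fold e in H1.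
  pose proof (Rmin_r (del / 2) (Rmin (t0 / 2) ((1 - t0) / 2))) as H2. fold e in H2.
  pose proof (Rmin_l (t0 / 2) ((1 - t0) / 2)). pose proof (Rmin_r (t0 / 2) ((1 - t0) / 2)).
  set (p := t0 - e). set (q := t0 + e).
  assert (Hp : 0 < p) by (unfold p; lra). assert (Hq : q < 1) by (unfold q; lra).
  (* The first term bounds the branch [h] of the cutoff from below, the second one the parabola for
     every [n], since [INR (S n) >= 1]. *)
  exists p, q, (Rmin (h t0 / 2) (p * (1 - q))).
  split; auto. split; [unfold p, q; lra|]. split; auto. split.
  - apply Rmin_glb_lt; [lra|]. apply Rmult_lt_0_compat; lra.
  - intros n t Ht. unfold cutoff. eapply Rle_trans; [|apply Rmax_r].
    specialize (Hd t). apply Rmin_glb.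
    + eapply Rle_trans; [apply Rmin_l|].
      specialize (Hd ltac:(unfold p, q in Ht; apply Rabs_def1; lra)). apply Rabs_def2 in Hd. lra.
    + eapply Rle_trans; [apply Rmin_r|].
      assert (1 <= INR (S n)) by (rewrite S_INR; pose proof (pos_INR n); lra).
      assert (p * (1 - q) <= t * (1 - t)) by (apply Rmult_le_compat; lra).
      assert (0 <= p * (1 - q)) by (apply Rmult_le_pos; lra). nra.
Qed.

Lemma phi_pos (y : R) : 0 < y -> 0 < phi y.
Proof.
  intros Hy. assert (E : phi 0 = 0) by (rewrite <- (g0 g g_odd) at 1; apply phi_g).
  rewrite <- E. apply phi_incr, Hy.
Qed.

(** If [u 1 >= 0], the cone inequality keeps [u] above [kap] at the delayed times belonging to
    [[p, q]], so the flux drops there at rate at least [lam * h0 * a0]. For large [lam], [expansion]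
    would then force a height above [R0]. *)
Lemma expansion_threshold (R0 : R) :
  0 < R0 ->
  exists Lam N, 0 < Lam /\ forall lam n u w, Lam < lam -> (N <= n)%nat ->
    delayed_solution lam n u w -> (forall t, 0 <= t <= 1 -> u t <= R0) ->
    (exists s, 0 <= s <= 1 /\ u s = R0) -> u 1 < 0.
Proof.
  intros HR.
  destruct h_positive_interval as (p & q & h0 & Hp & Hpq & Hq & Hh0 & Hh).
  destruct (coeffs_pos _ _ _ _ _ _ cd_bounds) as (Hcm & Hdm & HcM & HdM).
  pose proof (cone_const_ge1 p1 p1_nonneg cm cM dm dM c d cd_bounds) as HC.
  set (C := cone_const p1 cm cM dm dM) in *.
  (* From index [N] on the delay is shorter than [p / 2], so delayed times stay in [[p / 2, q]],
     where [t * (1 - t) >= p / 2 * (1 - q)]; the cone inequality then yields this level. *)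
  set (kap := p / 2 * (1 - q) * R0 / C).
  assert (Hk0 : 0 < p / 2 * (1 - q)) by (apply Rmult_lt_0_compat; lra).
  assert (Hkap : 0 < kap).
  { apply Rdiv_lt_0_compat; [|lra]. apply Rmult_lt_0_compat; auto. }
  assert (HkapR : kap <= R0).
  { unfold kap. apply Rle_div_l; [lra|].
    assert (p / 2 * (1 - q) <= 1 * 1) by (apply Rmult_le_compat; lra). nra. }
  destruct (continuity_ab_min F kap R0 HkapR (fun x _ => F_cont x)) as (x0 & Hmin & Hx0).
  set (a0 := F x0) in *. assert (Ha0 : 0 < a0) by (apply F_pos; lra).
  set (L := (q - p) / 4). assert (HL : 0 < L) by (unfold L; lra).
  (* The drop rate for which the lower bound in [expansion] equals [R0 + 1]. *)
  set (Q0 := phi ((R0 + 1) * cM / L) * dM / L).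
  assert (HQ0 : 0 < Q0).
  { apply Rdiv_lt_0_compat; auto. apply Rmult_lt_0_compat; auto. apply phi_pos.
    apply Rdiv_lt_0_compat; auto. apply Rmult_lt_0_compat; lra. }
  destruct (archimed_cor1 (p / 2) ltac:(lra)) as (N & HN & HN0).
  assert (Hha : 0 < h0 * a0) by (apply Rmult_lt_0_compat; auto).
  exists (Q0 / (h0 * a0)), N. split; [apply Rdiv_lt_0_compat; auto|].
  intros lam n u w Hlam Hn (Hprof & Hu0 & qq & Hw & Hqq) Hu (s & Hs & Hus).
  destruct (Rlt_dec (u 1) 0) as [|Hu1]; auto. exfalso.
  assert (Hlam0 : 0 < lam).
  { assert (0 < Q0 / (h0 * a0)) by (apply Rdiv_lt_0_compat; auto). lra. }
  set (Q := lam * h0 * a0).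
  assert (HQ : Q0 <= Q).
  { apply Rlt_div_l in Hlam; auto. unfold Q. lra. }
  assert (Hdelta : / INR (S n) < p / 2).
  { eapply Rle_lt_trans; [|exact HN]. apply Rinv_le_contravar.
    - apply lt_0_INR; auto.
    - apply le_INR. lia. }
  pose proof (delay_range n) as Hdr.
  assert (Hexp : g (Q * ((q - p) / 4) / dM) / cM * ((q - p) / 4) <= R0).
  { apply (expansion g g_odd g_incr cm cM dm dM c d u w p q Q R0); auto.
    - lra.
    - intros a b Ha Hab Hb.
      enough (Q * (b - a) <= - w b - - w a) by lra.
      apply (deriv_lb_increment (fun t => - w t) (fun t => - - qq t)); auto.
      + intros t _. apply (derivable_pt_lim_opp w), Hw.
      + intros t Ht. rewrite Ropp_involutive, Hqq by lra. unfold Q.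
        set (tau := t - / INR (S n)).
        assert (Htau : p / 2 <= tau <= q) by (unfold tau; lra).
        pose proof (cone g p1 g_odd g_incr p1_nonneg g_mul cm cM dm dM c d u w tau s cd_bounds Hprof
          ltac:(lra) ltac:(lra) ltac:(lra) Hs) as Hcone.
        fold C in Hcone. rewrite Hus in Hcone.
        assert (Hut : kap <= u tau).
        { unfold kap. apply Rle_div_l; [lra|]. rewrite (Rmult_comm (u tau)).
          eapply Rle_trans; [|exact Hcone]. apply Rmult_le_compat_r; [lra|].
          apply Rmult_le_compat; lra. }
        pose proof (Hmin (u tau) (conj Hut (Hu tau ltac:(lra)))) as HFu.
        pose proof (Hh n t ltac:(lra)) as Hht.
        rewrite !Rmult_assoc. apply Rmult_le_compat_l; [lra|].
        apply Rmult_le_compat; lra.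
    - intros t Ht. split; [|apply Hu; lra].
      apply (profile_nonneg g g_odd g_incr cm cM dm dM c d u w); auto; lra. }
  fold L in Hexp.
  assert (HgQ : (R0 + 1) * cM / L <= g (Q * L / dM)).
  { rewrite <- (g_phi ((R0 + 1) * cM / L)). apply (g_le g g_incr).
    apply Rle_div_r; auto.
    assert (Q0 * L = phi ((R0 + 1) * cM / L) * dM) by (unfold Q0; field; lra).
    assert (Q0 * L <= Q * L) by (apply Rmult_le_compat_r; lra). lra. }
  assert (Hfin : (R0 + 1) * cM / L / cM * L <= g (Q * L / dM) / cM * L).
  { apply Rmult_le_compat_r; [lra|]. unfold Rdiv at 1 3.
    apply Rmult_le_compat_r; [left; apply Rinv_0_lt_compat; auto|auto]. }
  replace ((R0 + 1) * cM / L / cM * L) with (R0 + 1) in Hfin by (field; lra). lra.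
Qed.

Context (psi2 : R -> R).
Context (psi2_nonneg : forall x, 0 <= x -> 0 <= psi2 x).
Context (phi_mul : forall x y, 0 <= x -> 0 <= y -> phi (x * y) <= phi x * psi2 y).

(** Suppose [u 1 <= 0]. Then [compression] gives [m <= g (phi m / (2 * (k + 1))) * B / cm], that is,
    [phi (m * cm / B) <= phi m / (2 * (k + 1))]. But the upper half of condition (A) gives
    [phi m <= phi (m * cm / B) * k], a contradiction. *)
Lemma undershoot (lam : R) :
  0 < lam ->
  exists eps, 0 < eps /\ forall n u w m,
    delayed_solution lam n u w -> 0 <= w 0 -> 0 < m ->
    (forall t, 0 <= t <= 1 -> u t <= m) -> (exists s, 0 <= s <= 1 /\ u s = m) ->
    (forall x, x <= m -> F x <= eps * phi m) -> 0 < u 1.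
Proof.
  intros Hlam.
  destruct (coeffs_pos _ _ _ _ _ _ cd_bounds) as (Hcm & Hdm & HcM & HdM).
  set (B := Rmax 1 (Rmax (Jl (1/2) - ll) (Jr (1/2) - lr))).
  assert (HB1 : 1 <= B) by apply Rmax_l.
  assert (HB2 : Rmax (Jl (1/2) - ll) (Jr (1/2) - lr) <= B) by apply Rmax_r.
  pose proof (Rmax_l (Jl (1/2) - ll) (Jr (1/2) - lr)).
  pose proof (Rmax_r (Jl (1/2) - ll) (Jr (1/2) - lr)).
  assert (Hpsi : 0 <= psi2 (B / cm)) by (apply psi2_nonneg, Rdiv_nonneg; lra).
  set (k := psi2 (B / cm)) in *.
  (* Fitted so that [2 * lam * eps / dm = 1 / (2 * (k + 1))], with [k + 1] because [k] is only known
     to be nonnegative. It depends on [lam], but neither on [n] nor on [m]. *)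
  exists (dm / (4 * lam * (k + 1))).
  assert (Hden : 0 < 4 * lam * (k + 1)) by (apply Rmult_lt_0_compat; lra).
  assert (Heps : 0 < dm / (4 * lam * (k + 1))) by (apply Rdiv_lt_0_compat; auto).
  split; auto. set (eps := dm / (4 * lam * (k + 1))) in *.
  intros n u w m Hds Hw0 Hm Hu (s & Hs & Hus) HF.
  destruct (Rlt_dec 0 (u 1)) as [|Hu1]; auto. exfalso.
  pose proof (phi_pos m Hm) as Hphim.
  pose proof (compression lam n u w m (eps * phi m) B s Hlam
    ltac:(apply Rmult_le_pos; lra) Hds Hw0 ltac:(lra) Hu HF ltac:(lra) ltac:(lra) ltac:(lra) Hs)
    as Hcomp.
  rewrite Hus in Hcomp.
  assert (E : 2 * (lam * (eps * phi m)) / dm = phi m / (2 * (k + 1))).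
  { unfold eps. field. repeat split; lra. }
  rewrite E in Hcomp.
  apply Rle_div_r in Hcomp; auto.
  assert (Hg : m * cm / B <= g (phi m / (2 * (k + 1)))).
  { apply Rle_div_l; lra. }
  assert (Hphi : phi (m * cm / B) <= phi m / (2 * (k + 1))).
  { rewrite <- (phi_g (phi m / (2 * (k + 1)))).
    destruct Hg as [Hg|Hg]; [left; apply phi_incr, Hg|rewrite Hg; right; auto]. }
  pose proof (phi_mul (m * cm / B) (B / cm)) as Hmul.
  replace (m * cm / B * (B / cm)) with m in Hmul by (field; lra). fold k in Hmul.
  specialize (Hmul ltac:(apply Rdiv_nonneg; [apply Rmult_le_pos|]; lra)
    ltac:(apply Rdiv_nonneg; lra)).
  assert (phi (m * cm / B) * k <= phi m / (2 * (k + 1)) * k) by (apply Rmult_le_compat_r; auto).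
  assert (phi m / (2 * (k + 1)) * k < phi m); [|lra].
  replace (phi m / (2 * (k + 1)) * k) with (phi m * (k / (2 * (k + 1)))) by (field; lra).
  rewrite <- (Rmult_1_r (phi m)) at 2. apply Rmult_lt_compat_l; auto.
  apply Rlt_div_l; lra.
Qed.

(** While [u] stays below [K], the flux loses at most [A'] on [0,1]. Starting from [A' + y] it keeps
    at least [y], enough to carry [u 1] to [K' + 1]. The initial flux depends on [n] through the
    bound on the cutoff; this is harmless, as it only provides an end point for the intermediate
    value theorem at fixed [n]. *)
Lemma steep_shots_high (lam K : R) (n : nat) :
  0 < lam -> exists s1, 0 < s1 /\ forall u w, delayed_solution lam n u w -> w 0 = s1 ->
    exists t, 0 <= t <= 1 /\ K <= u t.
Proof.
  intros Hlam.
  destruct (coeffs_pos _ _ _ _ _ _ cd_bounds) as (Hcm & Hdm & HcM & HdM).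
  destruct (F_bounded (Rmax 0 K)) as (A & HA & HF).
  destruct (cont_bounded (cutoff n) 0 1 ltac:(lra) (cutoff_cont n)) as (B & HB & Hcut).
  set (K' := Rmax 0 K) in *. assert (HK' : 0 <= K') by apply Rmax_l.
  assert (HKK : K <= K') by apply Rmax_r.
  set (A' := lam * B * A).
  assert (HA' : 0 < A') by (repeat apply Rmult_lt_0_compat; auto).
  assert (Hph : 0 < phi ((K' + 1) * cM)).
  { apply phi_pos. apply Rmult_lt_0_compat; lra. }
  set (y := dM * phi ((K' + 1) * cM)).
  assert (Hy : 0 < y) by (apply Rmult_lt_0_compat; auto).
  exists (A' + y). split; [lra|].
  intros u w (Hp & Hu0 & q & Hw & Hq) Hw0.
  apply NNPP. intros Hn.
  assert (Hu : forall t, 0 <= t <= 1 -> u t < K).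
  { intros t Ht. destruct (Rlt_dec (u t) K); auto. exfalso; apply Hn. exists t; lra. }
  assert (Hqb : forall t, 0 <= t <= 1 -> q t <= A').
  { intros t Ht. rewrite Hq by lra. set (tau := t - / INR (S n)).
    pose proof (delay_range n) as Hr.
    assert (Htau : u tau <= K').
    { destruct (Rle_dec 0 tau) as [H0|H0].
      - specialize (Hu tau ltac:(unfold tau in *; lra)). lra.
      - pose proof (rise_lower g g_odd g_incr cm cM dm dM c d u w tau 0 cd_bounds Hp
          ltac:(lra) ltac:(lra)) as Hri.
        assert (0 <= g (w 0 / dM) / cM * (0 - tau)); [|lra].
        apply Rmult_le_pos; [|lra]. apply Rdiv_nonneg; [|lra].
        apply (g_nonneg g g_odd g_incr), Rdiv_nonneg; lra. }
    pose proof (HF _ Htau). pose proof (F_nonneg (u tau)).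
    specialize (Hcut t Ht). pose proof (proj1 (cutoff_le_parabola n t)).
    rewrite Rabs_right in Hcut by lra.
    unfold A'. rewrite !Rmult_assoc. apply Rmult_le_compat_l; [lra|].
    apply Rmult_le_compat; lra. }
  assert (Hw1 : y <= w 1).
  { enough (- w 1 - - w 0 <= A' * (1 - 0)) by lra.
    apply (deriv_ub_increment (fun t => - w t) (fun t => - - q t)); [lra| |].
    - intros t _. apply (derivable_pt_lim_opp w), Hw.
    - intros t Ht. rewrite Ropp_involutive. auto. }
  pose proof (rise_lower g g_odd g_incr cm cM dm dM c d u w 0 1 cd_bounds Hp ltac:(lra) ltac:(lra))
    as Hri.
  assert (Hgw : (K' + 1) * cM <= g (w 1 / dM)).
  { rewrite <- (g_phi ((K' + 1) * cM)). apply (g_le g g_incr). apply Rle_div_r; auto.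
    unfold y in Hw1. lra. }
  apply Rle_div_r in Hgw; auto.
  specialize (Hu 1 ltac:(lra)). lra.
Qed.

Definition admissible (lam K : R) (n : nat) (u w : R -> R) : Prop :=
  delayed_solution lam n u w /\ u 1 = 0 /\ forall t, 0 <= t <= 1 -> u t <= K.

Lemma shoot (lam : R) (n : nat) :
  0 < lam ->
  exists (U W : R -> R -> R) (m : R -> R),
    (forall s, delayed_solution lam n (U s) (W s) /\ W s 0 = s) /\
    (forall s, (exists t, 0 <= t <= 1 /\ U s t = m s) /\ forall t, 0 <= t <= 1 -> U s t <= m s) /\
    continuity m /\ continuity (fun s => U s 1) /\ m 0 = 0 /\
    (forall s, 0 < s <-> 0 < m s) /\
    (forall K, exists s1, 0 < s1 /\ K <= m s1).
Proof.
  intros Hlam.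
  destruct (delayed_solutions_exist lam n Hlam) as (U & W & HUW & HUC).
  assert (Hcont : forall s, continuity (U s)).
  { intros s t. eapply derivable_pt_lim_cont. apply (proj1 (proj1 (HUW s))). }
  destruct (shot_max_cont U HUC Hcont) as (m & Hm & Hms).
  assert (Hpos : forall s, 0 < s <-> 0 < m s).
  { intros s. destruct (HUW s) as [Hds HW0], (Hms s) as [(t & Ht & Et) Hmax]. split; intros Hs.
    - destruct (initially_increasing lam n _ _ Hds ltac:(lra)) as (r & Hr & Hur).
      specialize (Hmax r Hr). lra.
    - rewrite <- HW0. apply (initial_flux_pos lam n (U s) (W s) t Hds); lra. }
  exists U, W, m. split; auto. split; auto. split; auto.
  split; [apply shot_end_cont, HUC|]. split; [|split]; auto.
  - destruct (HUW 0) as [(_ & HU0 & _) _]. destruct (Hms 0) as [_ Hmax].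
    specialize (Hmax 0 ltac:(lra)). pose proof (proj2 (Hpos 0)).
    destruct (Rlt_dec 0 (m 0)); lra.
  - intros K. destruct (steep_shots_high lam K n Hlam) as (s1 & Hs1 & Hhigh).
    exists s1. split; auto. destruct (HUW s1) as [Hds HW0].
    destruct (Hhigh _ _ Hds HW0) as (t & Ht & HK). destruct (Hms s1) as [_ Hmax].
    specialize (Hmax t Ht). lra.
Qed.

(** The point with [r <= u s] is recorded because this lower bound survives the limit and excludes
    the zero function. *)
Lemma approximate_below (lam R0 r : R) (n : nat) :
  0 < lam -> 0 < r < R0 ->
  (forall u w, delayed_solution lam n u w -> (forall t, 0 <= t <= 1 -> u t <= R0) ->
    (exists s, 0 <= s <= 1 /\ u s = R0) -> u 1 < 0) ->
  (forall u w m, delayed_solution lam n u w -> 0 <= w 0 -> 0 < m <= r ->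
    (forall t, 0 <= t <= 1 -> u t <= m) -> (exists s, 0 <= s <= 1 /\ u s = m) -> 0 < u 1) ->
  exists u w, admissible lam R0 n u w /\ exists s, 0 <= s <= 1 /\ r <= u s.
Proof.
  intros Hlam Hr Hover Hunder.
  destruct (shoot lam n Hlam) as (U & W & m & HUW & Hms & Hm & He & Hm0 & Hpos & Hhigh).
  destruct (Hhigh R0) as (s1 & Hs1 & HR).
  destruct (shooting_below m (fun s => U s 1) R0 r s1) as (s & Hs & Hes & Hmr); auto.
  - intros s Hs. apply (proj1 (Hpos s)), Hs.
  - intros s Hs. destruct (Hms s) as [Hex Hmax]. rewrite Hs in Hex, Hmax.
    apply (Hover (U s) (W s)); auto. apply HUW.
  - intros s Hs. destruct (Hms s) as [Hex Hmax].
    assert (0 < s) by (apply (proj2 (Hpos s)); lra).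
    apply (Hunder (U s) (W s) (m s)); auto; [apply HUW|].
    rewrite (proj2 (HUW s)). lra.
  - destruct (Hms s) as [(t & Ht & Et) Hmax]. exists (U s), (W s). split; [split; [|split]|].
    + apply HUW.
    + auto.
    + intros t' Ht'. specialize (Hmax t' Ht'). lra.
    + exists t. lra.
Qed.

Lemma approximate_above (lam R0 K : R) (n : nat) :
  0 < lam -> 0 < R0 < K ->
  (forall u w, delayed_solution lam n u w -> (forall t, 0 <= t <= 1 -> u t <= R0) ->
    (exists s, 0 <= s <= 1 /\ u s = R0) -> u 1 < 0) ->
  (forall u w m, delayed_solution lam n u w -> 0 <= w 0 -> K <= m ->
    (forall t, 0 <= t <= 1 -> u t <= m) -> (exists s, 0 <= s <= 1 /\ u s = m) -> 0 < u 1) ->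
  exists u w, admissible lam K n u w /\ exists s, 0 <= s <= 1 /\ R0 <= u s.
Proof.
  intros Hlam Hr Hover Hunder.
  destruct (shoot lam n Hlam) as (U & W & m & HUW & Hms & Hm & He & Hm0 & Hpos & Hhigh).
  destruct (Hhigh K) as (s1 & Hs1 & HR).
  destruct (shooting_above m (fun s => U s 1) R0 K s1) as (s & Hs & Hes & Hmr); auto.
  - intros s Hs. destruct (Hms s) as [Hex Hmax]. rewrite Hs in Hex, Hmax.
    apply (Hover (U s) (W s)); auto. apply HUW.
  - intros s Hs. destruct (Hms s) as [Hex Hmax].
    assert (0 < s) by (apply (proj2 (Hpos s)); lra).
    apply (Hunder (U s) (W s) (m s)); auto; [apply HUW|].
    rewrite (proj2 (HUW s)). lra.
  - destruct (Hms s) as [(t & Ht & Et) Hmax]. exists (U s), (W s). split; [split; [|split]|].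
    + apply HUW.
    + auto.
    + intros t' Ht'. specialize (Hmax t' Ht'). lra.
    + exists t. lra.
Qed.

(** * Compactness of delayed solutions and passage to the limit *)

Lemma phi_nonneg (y : R) : 0 <= y -> 0 <= phi y.
Proof.
  intros [Hy| <-]; [left; apply phi_pos, Hy|].
  rewrite <- (g0 g g_odd) at 2. rewrite phi_g. right; auto.
Qed.

(** A positive flux at [t] was at least as large before, so it has raised [u] by at least
    [g (w t / dM) / cM * t], while [u t <= K]; inverting [g] gives the bound. The coefficients are
    arguments so that the reflected ones can be inserted. *)
Lemma flux_upper (c' d' u w : R -> R) (K t : R) :
  coeffs cm cM dm dM c' d' -> profile g c' d' u w -> 0 <= K -> 0 <= u 0 -> u t <= K -> 0 < t ->
  w t <= dM * phi (K * cM / t).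
Proof.
  intros Hc Hp HK Hu0 Hut Ht.
  destruct (coeffs_pos _ _ _ _ _ _ Hc) as (Hcm & Hdm & HcM & HdM).
  assert (Hr : 0 <= phi (K * cM / t)).
  { apply phi_nonneg, Rdiv_nonneg; auto. apply Rmult_le_pos; lra. }
  destruct (Rle_dec (w t) 0) as [Hw|Hw].
  - assert (0 <= dM * phi (K * cM / t)) by (apply Rmult_le_pos; lra). lra.
  - pose proof (rise_lower g g_odd g_incr cm cM dm dM c' d' u w 0 t Hc Hp ltac:(lra) ltac:(lra)) as Hri.
    rewrite Rminus_0_r in Hri.
    assert (Hg : g (w t / dM) <= K * cM / t).
    { apply Rle_div_r; auto.
      assert (E : g (w t / dM) / cM * t <= K) by lra.
      replace (g (w t / dM) * t) with (g (w t / dM) / cM * t * cM) by (field; lra).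
      apply Rmult_le_compat_r; lra. }
    assert (Hl : w t / dM <= phi (K * cM / t)).
    { rewrite <- (phi_g (w t / dM)).
      destruct Hg as [Hg|Hg]; [left; apply phi_incr, Hg|rewrite Hg; right; auto]. }
    apply Rle_div_l in Hl; auto. lra.
Qed.

Lemma flux_bound (u w : R -> R) (K eta t : R) :
  profile g c d u w -> 0 <= K -> 0 <= u 0 -> 0 <= u 1 ->
  (forall t, 0 <= t <= 1 -> u t <= K) -> 0 < eta -> eta <= t <= 1 - eta ->
  Rabs (w t) <= dM * phi (K * cM / eta).
Proof.
  intros Hp HK Hu0 Hu1 Hu Heta Ht.
  destruct (coeffs_pos _ _ _ _ _ _ cd_bounds) as (Hcm & Hdm & HcM & HdM).
  assert (Hmon : forall s, eta <= s -> dM * phi (K * cM / s) <= dM * phi (K * cM / eta)).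
  { intros s Hs. apply Rmult_le_compat_l; [lra|].
    assert (Hle : K * cM / s <= K * cM / eta).
    { apply Rdiv_le_compat; [|lra]. split; [apply Rmult_le_pos; lra|lra]. }
    destruct Hle as [Hle|Hle]; [left; apply phi_incr, Hle|rewrite Hle; right; auto]. }
  apply Rabs_le. split.
  - pose proof (flux_upper _ _ _ _ K (1 - t) (coeffs_reflect _ _ _ _ _ _ cd_bounds)
      (profile_reflect _ g_odd _ _ _ _ Hp) HK) as Hf.
    cbv beta in Hf. replace (1 - (1 - t)) with t in Hf by ring. rewrite Rminus_0_r in Hf.
    specialize (Hf Hu1 (Hu t ltac:(lra)) ltac:(lra)). specialize (Hmon (1 - t) ltac:(lra)). lra.
  - pose proof (flux_upper c d u w K t cd_bounds Hp HK Hu0 (Hu t ltac:(lra)) ltac:(lra)).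
    specialize (Hmon t ltac:(lra)). lra.
Qed.

Lemma rate_abs (w B t : R) : Rabs w <= B -> Rabs (g (w / d t) / c t) <= g (B / dm) / cm.
Proof.
  intros Hw. apply Rabs_le_between in Hw.
  pose proof (rate_upper g g_odd g_incr cm cM dm dM c d t w B cd_bounds ltac:(lra) ltac:(lra)).
  pose proof (rate_upper g g_odd g_incr cm cM dm dM c d t (- w) B cd_bounds ltac:(lra) ltac:(lra)) as Hn.
  replace (- w / d t) with (- (w / d t)) in Hn by (unfold Rdiv; ring).
  rewrite g_odd in Hn. unfold Rdiv in *. apply Rabs_le. lra.
Qed.

Lemma half_bound_vanishes (H' J : R -> R) (l a b eps : R) :
  half_primitive p1 H' J l -> 0 <= a -> 0 <= b -> 0 < eps ->
  exists del, 0 < del /\ forall t, 0 < t < del -> t < 1 -> (a * t + b * (J t - l)) / cm < eps.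
Proof.
  intros (_ & Hl & Hlim) Ha Hb He.
  destruct (coeffs_pos _ _ _ _ _ _ cd_bounds) as (Hcm & Hdm & HcM & HdM).
  assert (Hec : 0 < eps * cm) by (apply Rmult_lt_0_compat; auto).
  destruct (Hlim (eps * cm / (2 * (b + 1)))) as (del & Hdel & Hd).
  { apply Rdiv_lt_0_compat; lra. }
  assert (Hk : 0 < eps * cm / (2 * (a + 1))) by (apply Rdiv_lt_0_compat; lra).
  exists (Rmin del (eps * cm / (2 * (a + 1)))). split; [apply Rmin_glb_lt; auto|].
  intros t Ht Ht1.
  pose proof (Rmin_l del (eps * cm / (2 * (a + 1)))).
  pose proof (Rmin_r del (eps * cm / (2 * (a + 1)))).
  specialize (Hd t ltac:(lra) Ht1). specialize (Hl t ltac:(lra)).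
  assert (E1 : (a + 1) * t < eps * cm / 2).
  { replace (eps * cm / 2) with ((a + 1) * (eps * cm / (2 * (a + 1)))) by (field; lra).
    apply Rmult_lt_compat_l; lra. }
  assert (E2 : (b + 1) * (J t - l) < eps * cm / 2).
  { replace (eps * cm / 2) with ((b + 1) * (eps * cm / (2 * (b + 1)))) by (field; lra).
    apply Rmult_lt_compat_l; lra. }
  apply Rlt_div_l; [lra|]. lra.
Qed.

Lemma delay_vanishes (U : (nat -> Prop) -> Prop) (N : nat) :
  Filter U -> filter_le U eventually ->
  filterlim (fun n => / INR (S (n + N))) U (locally 0).
Proof.
  intros HF HU. apply filterlim_locally_eps; auto. intros eps He.
  destruct (archimed_cor1 eps He) as (M & HM & HM0).
  apply HU. exists M. intros n Hn.
  rewrite Rminus_0_r, Rabs_right.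
  - eapply Rle_lt_trans; [|exact HM]. apply Rinv_le_contravar.
    + apply lt_0_INR; auto.
    + apply le_INR. lia.
  - apply Rle_ge. pose proof (delay_range (n + N)). lra.
Qed.

Lemma cutoff_joint_limit (U : (nat -> Prop) -> Prop) (N : nat) (t : R) :
  Filter U -> filter_le U eventually -> 0 < t < 1 ->
  filterlim (fun z => cutoff (fst z + N) (snd z)) (filter_prod U (locally t)) (locally (h t)).
Proof.
  intros HF HU Ht.
  set (eta := Rmin t (1 - t) / 2).
  pose proof (Rmin_l t (1 - t)). pose proof (Rmin_r t (1 - t)).
  assert (Heta : 0 < eta) by (assert (0 < Rmin t (1 - t)) by (apply Rmin_glb_lt; lra); unfold eta; lra).
  destruct (continuity_ab_maj h eta (1 - eta)) as (xm & Hmax & _).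
  { unfold eta; lra. }
  { intros s Hs. apply h_cont. lra. }
  (* On [[eta, 1 - eta]] one has [s * (1 - s) >= eta * eta], so from index [M] on the parabola
     exceeds the maximum of [h] there and the cutoff is [h] itself. *)
  destruct (INR_unbounded (h xm / (eta * eta))) as (M & HM).
  assert (Hee : 0 < eta * eta) by (apply Rmult_lt_0_compat; auto).
  eapply filterlim_ext_loc; [|eapply filterlim_comp;
    [apply filterlim_snd|apply continuity_pt_filterlim, h_cont, Ht]].
  apply Filter_prod with (fun n => (M <= n)%nat) (fun s => Rabs (s - t) < eta).
  - apply HU. exists M. auto.
  - exists (mkposreal eta Heta). intros y Hy; exact Hy.
  - intros n s Hn Hs. simpl. apply Rabs_def2 in Hs.
    assert (Hs' : eta <= s <= 1 - eta) by (unfold eta in *; lra).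
    specialize (Hmax s Hs'). unfold cutoff.
    assert (Hle : h s <= INR (S (n + N)) * (s * (1 - s))).
    { assert (Hb : h xm / (eta * eta) <= INR (S (n + N))).
      { apply Rle_trans with (INR M); [lra|]. apply le_INR. lia. }
      apply Rle_div_l in Hb; [|lra].
      assert (INR (S (n + N)) * (eta * eta) <= INR (S (n + N)) * (s * (1 - s))); [|lra].
      apply Rmult_le_compat_l; [apply pos_INR|]. apply Rmult_le_compat; lra. }
    rewrite Rmin_left by auto. rewrite Rmax_right; auto. apply h_nonneg; lra.
Qed.

Definition limit_solution (lam : R) (u w : R -> R) : Prop :=
  cont_on I01 u /\ u 0 = 0 /\ u 1 = 0 /\
  forall t, 0 < t < 1 ->
    derivable_pt_lim u t (g (w t / d t) / c t) /\
    derivable_pt_lim w t (- (lam * h t * F (u t))).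

Lemma delayed_limit (lam K r : R) (N : nat) :
  0 < lam -> 0 <= K -> 0 < r ->
  (forall n, (N <= n)%nat ->
    exists u w, admissible lam K n u w /\ exists s, 0 <= s <= 1 /\ r <= u s) ->
  exists u w, limit_solution lam u w /\
    forall t, 0 <= t <= 1 -> 0 <= u t <= K /\ t * (1 - t) * r <= cone_const p1 cm cM dm dM * u t.
Proof.
  intros Hlam HK Hr Hseq.
  destruct (choice_fun nat ((R -> R) * (R -> R)) (fun n p =>
    admissible lam K (n + N) (fst p) (snd p) /\ exists s, 0 <= s <= 1 /\ r <= fst p s)) as [xy Hxy].
  { intros n. destruct (Hseq (n + N)%nat) as (u & w & Huw); [lia|]. exists (u, w). exact Huw. }
  set (x := fun n => fst (xy n)). set (y := fun n => snd (xy n)).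
  assert (Hadm : forall n, admissible lam K (n + N) (x n) (y n)) by (intros n; apply Hxy).
  assert (Hbig : forall n, exists s, 0 <= s <= 1 /\ r <= x n s) by (intros n; apply Hxy).
  clearbody x y. clear Hxy xy Hseq.
  assert (Hprof : forall n, profile g c d (x n) (y n)) by (intros n; apply (proj1 (Hadm n))).
  assert (Hx0 : forall n, x n 0 = 0) by (intros n; apply (proj1 (Hadm n))).
  assert (Hx1 : forall n, x n 1 = 0) by (intros n; apply (proj2 (Hadm n))).
  assert (HxK : forall n t, 0 <= t <= 1 -> x n t <= K) by (intros n; apply (proj2 (Hadm n))).
  assert (Hxnn : forall n t, 0 <= t <= 1 -> 0 <= x n t).
  { intros n t Ht. apply (profile_nonneg g g_odd g_incr cm cM dm dM c d _ (y n)); auto.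
    - rewrite Hx0; lra.
    - rewrite Hx1; lra. }
  assert (Hy0 : forall n, 0 <= y n 0).
  { intros n. destruct (Hbig n) as (s & Hs & Hrs). left.
    apply (initial_flux_pos lam (n + N) (x n) (y n) s (proj1 (Hadm n))); lra. }
  destruct (F_bounded K) as (A & HA & HFA).
  assert (Hdrop := fun n => flux_drop_upper lam (n + N) (x n) (y n) K A Hlam (proj1 (Hadm n))
    (Hy0 n) HK (HxK n) HFA).
  assert (Hyd : forall n t, t <= 1 -> derivable_pt_lim (y n) t
    (- (lam * cutoff (n + N) t * F (x n (t - / INR (S (n + N))))))).
  { intros n t Ht. destruct (Hadm n) as [(_ & _ & q & Hq & Hq') _]. rewrite <- Hq' by auto. auto. }
  set (Bd := fun eta => dM * phi (K * cM / eta)).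
  assert (Hyb : forall n eta t, 0 < eta -> eta <= t <= 1 - eta -> Rabs (y n t) <= Bd eta).
  { intros n eta t Heta Ht. apply (flux_bound (x n)); auto; [rewrite Hx0|rewrite Hx1]; lra. }
  destruct nat_ultrafilter as (U & HPU & HUe & HUu).
  assert (HFU : Filter U) by apply HPU.
  destruct (choice_fun R R (fun t l => 0 <= t <= 1 -> filterlim (fun n => x n t) U (locally l)))
    as [u Hu].
  { intros t. destruct (classic (0 <= t <= 1)) as [Ht|Ht]; [|exists 0; tauto].
    destruct (ultra_lim U (fun n => x n t) K HPU HUu) as [l Hl]; [|eauto].
    intros n. apply Rabs_le. specialize (Hxnn n t Ht). specialize (HxK n t Ht). lra. }
  (* Unlike [u], the flux gets a limit only in the open interval: its bound [Bd] degenerates at 0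
     and 1. *)
  destruct (choice_fun R R (fun t l => 0 < t < 1 -> filterlim (fun n => y n t) U (locally l)))
    as [w Hw].
  { intros t. destruct (classic (0 < t < 1)) as [Ht|Ht]; [|exists 0; tauto].
    destruct (ultra_lim U (fun n => y n t) (Bd (Rmin t (1 - t))) HPU HUu) as [l Hl]; [|eauto].
    intros n. pose proof (Rmin_l t (1 - t)). pose proof (Rmin_r t (1 - t)).
    apply Hyb; [apply Rmin_glb_lt; lra|lra]. }
  assert (Hderiv : forall t, 0 < t < 1 ->
    derivable_pt_lim u t (g (w t / d t) / c t) /\
    derivable_pt_lim w t (- (lam * h t * F (u t)))).
  { intros t Ht.
    set (eta := Rmin t (1 - t) / 2).
    pose proof (Rmin_l t (1 - t)). pose proof (Rmin_r t (1 - t)).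
    assert (Hmin : 0 < Rmin t (1 - t)) by (apply Rmin_glb_lt; lra).
    assert (Heta : 0 < eta) by (unfold eta; lra).
    assert (Hnear : forall s, Rabs (s - t) < eta -> eta <= s <= 1 - eta).
    { intros s Hs. apply Rabs_def2 in Hs. unfold eta in *; lra. }
    assert (Hseg : forall s z, Rabs (s - t) < eta -> Rmin t s <= z <= Rmax t s -> Rabs (z - t) < eta).
    { intros s z Hs Hz. apply Rabs_def2 in Hs. revert Hz. unfold Rmin, Rmax; destruct Rle_dec;
        intros; apply Rabs_def1; lra. }
    assert (HG : Filter (filter_prod U (locally t)))
      by (apply filter_prod_filter; [auto|apply locally_filter]).
    destruct (continuity_ab_maj h eta (1 - eta)) as (xm & Hmax & Hxm).
    { unfold eta; lra. }
    { intros s Hs. apply h_cont. lra. }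
    assert (Hhm : 0 <= h xm) by (apply h_nonneg; lra).
    assert (JU : filterlim (fun z => x (fst z) (snd z)) (filter_prod U (locally t)) (locally (u t))).
    { apply equilipschitz_joint_limit with (g (Bd eta / dm) / cm) eta; auto.
      - eapply Rle_trans; [apply Rabs_pos|]. apply (rate_abs (y 0%nat t) (Bd eta) t).
        apply Hyb; auto. apply Hnear. rewrite Rminus_diag, Rabs_R0; auto.
      - intros n s Hs. eapply deriv_abs_increment.
        + intros z _. apply (Hprof n).
        + intros z Hz. apply rate_abs. apply Hyb; auto. apply Hnear, (Hseg s); auto.
      - apply Hu; lra. }
    assert (JW : filterlim (fun z => y (fst z) (snd z)) (filter_prod U (locally t)) (locally (w t))).
    { apply equilipschitz_joint_limit with (lam * A * h xm) eta; auto.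
      - repeat apply Rmult_le_pos; lra.
      - intros n s Hs. eapply deriv_abs_increment.
        + intros z Hz. apply Hyd. specialize (Hnear z (Hseg s z Hs Hz)). lra.
        + intros z Hz. specialize (Hnear z (Hseg s z Hs Hz)).
          destruct (proj2 (Hdrop n) _ z (Hyd n z ltac:(lra)) ltac:(lra)) as [Hq1 Hq2].
          cbv beta. rewrite Rabs_Ropp, Rabs_right by lra.
          eapply Rle_trans; [exact Hq2|]. apply Rmult_le_compat_l; [apply Rmult_le_pos; lra|auto]. }
    split.
    - apply (joint_limit_deriv U x (fun n s => g (y n s / d s) / c s) u t _ eta); auto.
      + intros n s _. apply (Hprof n).
      + intros s Hs. apply Hu. specialize (Hnear s Hs). lra.
      + assert (Hpos : 0 < c t /\ 0 < d t).
        { destruct cd_bounds as (? & ? & Hb). specialize (Hb t). lra. }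
        apply filterlim_real_mult; auto.
        * apply (filterlim_real_cont _ _ (fun z => y (fst z) (snd z) / d (snd z)) g); [|apply g_cont].
          apply filterlim_real_mult; auto.
          apply (filterlim_real_cont _ _ snd (fun s => / d s)); [apply filterlim_snd|].
          apply (continuity_pt_inv d); [apply d_cont|lra].
        * apply (filterlim_real_cont _ _ snd (fun s => / c s)); [apply filterlim_snd|].
          apply (continuity_pt_inv c); [apply c_cont|lra].
    - apply (joint_limit_deriv U y
        (fun n s => - (lam * cutoff (n + N) s * F (x n (s - / INR (S (n + N)))))) w t _ eta); auto.
      + intros n s Hs. apply Hyd. specialize (Hnear s Hs). lra.
      + intros s Hs. apply Hw. specialize (Hnear s Hs). lra.
      + apply (filterlim_real_cont _ _ (fun z => lam * cutoff (fst z + N) (snd z) *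
          F (x (fst z) (snd z - / INR (S (fst z + N))))) Ropp);
          [|apply (continuity_opp (fun a => a)), continuity_idf].
        apply filterlim_real_mult; auto.
        * apply filterlim_real_mult; auto; [apply filterlim_const|]. apply cutoff_joint_limit; auto.
        (* The delayed time moves with [n], so limits at fixed times do not suffice. The pair of the
           index and the delayed time tends to [filter_prod U (locally t)], along which [JU]
           applies. *)
        * apply (filterlim_real_cont _ _ (fun z => x (fst z) (snd z - / INR (S (fst z + N)))) F);
            [|apply F_cont].
          apply (filterlim_comp _ _ _ (fun z => (fst z, snd z - / INR (S (fst z + N))))
            (fun z => x (fst z) (snd z)) _ (filter_prod U (locally t))); [|exact JU].
          apply filterlim_pair; [apply filterlim_fst|].
          replace t with (t - 0) at 2 by ring.
          apply filterlim_real_minus; [auto|apply filterlim_snd|].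
          apply (filterlim_comp _ _ _ fst (fun n => / INR (S (n + N))) _ U);
            [apply filterlim_fst|apply delay_vanishes; auto]. }
  assert (Hu0 : u 0 = 0).
  { pose proof (filterlim_le_cst _ U _ _ 0 HPU (Hu 0 ltac:(lra))) as H1.
    pose proof (filterlim_ge_cst _ U _ _ 0 HPU (Hu 0 ltac:(lra))) as H2.
    cbv beta in *. apply Rle_antisym; [apply H1|apply H2]; apply filter_forall;
      intros n; rewrite Hx0; lra. }
  assert (Hu1 : u 1 = 0).
  { pose proof (filterlim_le_cst _ U _ _ 0 HPU (Hu 1 ltac:(lra))) as H1.
    pose proof (filterlim_ge_cst _ U _ _ 0 HPU (Hu 1 ltac:(lra))) as H2.
    cbv beta in *. apply Rle_antisym; [apply H1|apply H2]; apply filter_forall;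
      intros n; rewrite Hx1; lra. }
  assert (Hunn : forall t, 0 <= t <= 1 -> 0 <= u t).
  { intros t Ht. apply (filterlim_ge_cst _ U _ _ 0 HPU (Hu t Ht)). apply filter_forall. auto. }
  (* The coefficients of [half_bound] for the flux bound [Bd (1/2)] and the drop constant [lam * A].
     They are free of [n], so the bounds near both ends pass to the limit. *)
  set (a := g (2 * Bd (1/2) / dm)). set (b := g (2 * (lam * A) / dm)).
  destruct (coeffs_pos _ _ _ _ _ _ cd_bounds) as (Hcm & Hdm & HcM & HdM).
  assert (HB : 0 <= Bd (1/2)).
  { eapply Rle_trans; [apply Rabs_pos|apply (Hyb 0%nat (1/2) (1/2)); lra]. }
  assert (HlA : 0 <= lam * A) by (apply Rmult_le_pos; lra).
  assert (Ha : 0 <= a) by (apply (g_nonneg g g_odd g_incr), Rdiv_nonneg; lra).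
  assert (Hb : 0 <= b) by (apply (g_nonneg g g_odd g_incr), Rdiv_nonneg; lra).
  assert (Hleft : forall t, 0 < t <= 1/2 -> u t <= (a * t + b * (Jl t - ll)) / cm).
  { intros t Ht. apply (filterlim_le_cst _ U _ _ _ HPU (Hu t ltac:(lra))).
    apply filter_forall. intros n.
    apply (half_bound g p1 g_odd g_incr g_mul cm cM dm dM c d (x n) (y n) H); auto.
    - rewrite Hx0; lra.
    - pose proof (Hyb n (1/2) (1/2) ltac:(lra) ltac:(lra)) as Hyn.
      apply Rabs_le_between in Hyn. lra.
    - intros s Hs. apply (Hdrop n); lra. }
  assert (Hright : forall t, 0 < t <= 1/2 -> u (1 - t) <= (a * t + b * (Jr t - lr)) / cm).
  { intros t Ht. apply (filterlim_le_cst _ U _ _ _ HPU (Hu (1 - t) ltac:(lra))).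
    apply filter_forall. intros n.
    apply (half_bound g p1 g_odd g_incr g_mul cm cM dm dM (fun t => c (1 - t))
      (fun t => d (1 - t)) (fun t => x n (1 - t)) (fun t => - y n (1 - t))
      (fun s => - H (1 - s)) Jr lr (lam * A) (Bd (1/2)) t); auto.
    - apply coeffs_reflect, cd_bounds.
    - apply profile_reflect; auto.
    - rewrite Rminus_0_r, Hx1; lra.
    - pose proof (Hyb n (1/2) (1/2) ltac:(lra) ltac:(lra)) as Hyn.
      apply Rabs_le_between in Hyn. replace (1 - 1/2) with (1/2) by field. lra.
    - intros s Hs. apply reflected_drop; auto. apply (Hdrop n). }
  exists u, w. split; [split; [|split; [|split]]|]; auto.
  - intros t Ht eps He. destruct (classic (0 < t < 1)) as [Hti|Hti].
    + destruct (Hderiv t Hti) as [Hd _]. apply derivable_pt_lim_cont in Hd.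
      destruct (proj1 (continuity_pt_eps u t) Hd eps He) as (del & Hdel & Hdd).
      exists del; split; auto.
    + destruct (Req_dec t 0) as [->|Hne].
      * destruct (half_bound_vanishes H Jl ll a b eps half_l Ha Hb He) as (del & Hdel & Hd).
        exists (Rmin del (1/2)). split; [apply Rmin_glb_lt; lra|].
        intros z Hz Hzd. pose proof (Rmin_l del (1/2)). pose proof (Rmin_r del (1/2)).
        unfold I01 in Hz. rewrite Rminus_0_r, Rabs_right in Hzd by lra.
        rewrite Hu0, Rminus_0_r, Rabs_right by (apply Rle_ge, Hunn, Hz).
        destruct (Req_dec z 0) as [->|Hz0]; [lra|].
        specialize (Hleft z ltac:(lra)). specialize (Hd z ltac:(lra) ltac:(lra)). lra.
      * assert (t = 1) as -> by (unfold I01 in Ht; lra).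
        destruct (half_bound_vanishes _ Jr lr a b eps half_r Ha Hb He) as (del & Hdel & Hd).
        exists (Rmin del (1/2)). split; [apply Rmin_glb_lt; lra|].
        intros z Hz Hzd. pose proof (Rmin_l del (1/2)). pose proof (Rmin_r del (1/2)).
        unfold I01 in Hz. rewrite Rabs_minus_sym, Rabs_right in Hzd by lra.
        rewrite Hu1, Rminus_0_r, Rabs_right by (apply Rle_ge, Hunn, Hz).
        destruct (Req_dec z 1) as [->|Hz0]; [lra|].
        specialize (Hright (1 - z) ltac:(lra)). specialize (Hd (1 - z) ltac:(lra) ltac:(lra)).
        replace (1 - (1 - z)) with z in Hright by ring. lra.
  - intros t Ht. split; [split; auto|].
    + apply (filterlim_le_cst _ U _ _ _ HPU (Hu t Ht)). apply filter_forall. auto.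
    + pose proof (cone_const_ge1 p1 p1_nonneg cm cM dm dM c d cd_bounds) as HC.
      set (C := cone_const p1 cm cM dm dM) in *.
      rewrite (Rmult_comm C). apply Rle_div_l; [lra|].
      apply (filterlim_ge_cst _ U _ _ _ HPU (Hu t Ht)). apply filter_forall. intros n.
      apply Rle_div_l; [lra|]. rewrite (Rmult_comm (x n t)).
      (* The point [s] varies with [n]; the cone inequality turns it into a lower bound at the fixed
         time [t]. *)
      destruct (Hbig n) as (s & Hs & Hrs).
      eapply Rle_trans; [|apply (cone g p1 g_odd g_incr p1_nonneg g_mul cm cM dm dM c d (x n) (y n) t s);
        auto; [rewrite Hx0|rewrite Hx1]; lra].
      apply Rmult_le_compat_l; auto. apply Rmult_le_pos; lra.
Qed.

(** [Lam] comes from [R0] alone, whereas [eps], and with it [r], depends on [lam]. In the limit [r]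
    serves only positivity, so no uniformity in [lam] is required of it. *)
Lemma small_solutions (R0 : R) :
  (forall eps, 0 < eps -> exists r, 0 < r /\ forall m x, 0 < m <= r -> x <= m -> F x <= eps * phi m) ->
  0 < R0 ->
  exists Lam, 0 < Lam /\ forall lam, Lam < lam -> exists u w,
    limit_solution lam u w /\ (forall t, 0 <= t <= 1 -> u t <= R0) /\
    (forall t, 0 < t < 1 -> 0 < u t).
Proof.
  intros Hsmall HR.
  destruct (expansion_threshold R0 HR) as (Lam & N & HLam & Hover).
  exists Lam. split; auto. intros lam Hlam.
  destruct (undershoot lam ltac:(lra)) as (eps & Heps & Hunder).
  destruct (Hsmall eps Heps) as (r0 & Hr0 & HF).
  set (r := Rmin r0 (R0 / 2)).
  assert (Hr : 0 < r) by (apply Rmin_glb_lt; lra).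
  assert (Hrr : r <= r0) by apply Rmin_l. assert (HrR : r <= R0 / 2) by apply Rmin_r.
  destruct (delayed_limit lam R0 r N) as (u & w & Huw & Hb); try lra.
  - intros n Hn. apply approximate_below; try lra.
    + intros u w. apply (Hover lam n u w); auto.
    + intros u w m Hds Hw0 Hm Hu Hs. apply (Hunder n u w m); auto; [lra|].
      intros x Hx. apply HF; auto; lra.
  - exists u, w. split; auto. split.
    + intros t Ht. apply Hb, Ht.
    + intros t Ht. destruct (Hb t ltac:(lra)) as [Hu Hc].
      destruct (proj1 Hu) as [|E]; auto. rewrite <- E, Rmult_0_r in Hc.
      assert (0 < t * (1 - t) * r) by (repeat apply Rmult_lt_0_compat; lra). lra.
Qed.

Lemma large_solutions (M : R) :
  (forall eps, 0 < eps -> exists K, 0 < K /\ forall m x, K <= m -> x <= m -> F x <= eps * phi m) ->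
  0 < M ->
  exists Lam, 0 < Lam /\ forall lam, Lam < lam -> exists u w,
    limit_solution lam u w /\ M <= u (1/2) /\ (forall t, 0 < t < 1 -> 0 < u t).
Proof.
  intros Hlarge HM.
  pose proof (cone_const_ge1 p1 p1_nonneg cm cM dm dM c d cd_bounds) as HC.
  set (C := cone_const p1 cm cM dm dM) in *.
  (* At [t = 1/2] the cone inequality reads [R0 / 4 <= C * u (1/2)], which for this [R0] is
     [M <= u (1/2)]. *)
  set (R0 := 4 * C * M).
  assert (HR : 0 < R0) by (apply Rmult_lt_0_compat; lra).
  destruct (expansion_threshold R0 HR) as (Lam & N & HLam & Hover).
  exists Lam. split; auto. intros lam Hlam.
  destruct (undershoot lam ltac:(lra)) as (eps & Heps & Hunder).
  destruct (Hlarge eps Heps) as (K0 & HK0 & HF).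
  destruct (delayed_limit lam (R0 + K0) R0 N) as (u & w & Huw & Hb); try lra.
  - intros n Hn. apply approximate_above; try lra.
    + intros u w. apply (Hover lam n u w); auto.
    + intros u w m Hds Hw0 Hm Hu Hs. apply (Hunder n u w m); auto; [lra|].
      intros x Hx. apply HF; auto; lra.
  - exists u, w. split; auto. split.
    + destruct (Hb (1/2) ltac:(lra)) as [_ Hc]. fold C in Hc. unfold R0 in Hc.
      apply Rmult_le_reg_l with C; lra.
    + intros t Ht. destruct (Hb t ltac:(lra)) as [Hu Hc].
      destruct (proj1 Hu) as [|E]; auto. rewrite <- E, Rmult_0_r in Hc.
      assert (0 < t * (1 - t) * R0) by (repeat apply Rmult_lt_0_compat; lra). lra.
Qed.

End Problem.

(** * The boundary value problem *)


Lemma supnorm_lub (u : R -> R) :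
  cont_on I01 u -> is_lub (fun y => exists t, 0 <= t <= 1 /\ y = Rabs (u t)) (supnorm u).
Proof.
  intros Hu. unfold supnorm. apply epsilon_spec.
  destruct (cont_bounded (fun t => u (clamp t)) 0 1 ltac:(lra)
    (cont_on_retract I01 u clamp Hu continuity_clamp clamp_in)) as (K & HK & Hb).
  destruct (completeness (fun y => exists t, 0 <= t <= 1 /\ y = Rabs (u t))) as [l Hl].
  - exists K. intros y (t & Ht & ->). specialize (Hb t Ht). cbv beta in Hb.
    rewrite clamp_id in Hb; auto.
  - exists (Rabs (u 0)), 0. split; [lra|auto].
  - exists l. exact Hl.
Qed.

Lemma supnorm_ge (u : R -> R) (t : R) : cont_on I01 u -> 0 <= t <= 1 -> u t <= supnorm u.
Proof.
  intros Hu Ht. apply Rle_trans with (Rabs (u t)); [apply Rle_abs|].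
  apply (proj1 (supnorm_lub u Hu)). eauto.
Qed.

Lemma supnorm_le (u : R -> R) (K : R) :
  cont_on I01 u -> (forall t, 0 <= t <= 1 -> Rabs (u t) <= K) -> supnorm u <= K.
Proof.
  intros Hu HK. apply (proj2 (supnorm_lub u Hu)). intros y (t & Ht & ->). auto.
Qed.

Lemma pos_solution_supnorm_pos (phi c d h f : R -> R) (lam : R) (u : R -> R) :
  is_pos_solution phi c d h f lam u -> 0 < supnorm u.
Proof.
  intros [(Hu & _) Hpos]. pose proof (supnorm_ge u (1/2) Hu ltac:(lra)).
  specialize (Hpos (1/2) ltac:(lra)). lra.
Qed.

(** A diagonal choice: for given [lam], the finitely many levels [k <= N] with [Lam k < lam] are met
    at once by a solution for the highest of them, because the levels are nested. *)
Lemma threshold_selection (A : Type) (P : R -> A -> Prop) (Q : nat -> A -> Prop) :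
  (forall k x, Q (S k) x -> Q k x) ->
  (forall k, exists Lam, 0 < Lam /\ forall lam, Lam < lam -> exists x, P lam x /\ Q k x) ->
  exists Lam (X : R -> A), 0 < Lam /\
    (forall lam, Lam < lam -> P lam (X lam) /\ Q 0%nat (X lam)) /\
    forall k, exists M, forall lam, M < lam -> Q k (X lam).
Proof.
  intros HQ Hex.
  destruct (choice_fun _ _ _ Hex) as [Lam HLam].
  assert (HQm : forall k j x, (j <= k)%nat -> Q k x -> Q j x).
  { intros k j x Hjk. induction Hjk; auto. }
  assert (Hsel : forall lam N, Lam 0%nat < lam ->
    exists x, P lam x /\ forall k, (k <= N)%nat -> Lam k < lam -> Q k x).
  { intros lam N H0. induction N as [|N (x & HP & Hx)].
    - destruct (proj2 (HLam 0%nat) lam H0) as (x & HP & Hx). exists x. split; auto.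
      intros k Hk _. replace k with 0%nat by lia. auto.
    - destruct (Rlt_dec (Lam (S N)) lam) as [Hl|Hl].
      + destruct (proj2 (HLam (S N)) lam Hl) as (x' & HP' & Hx'). exists x'. split; auto.
        intros k Hk _. apply HQm with (S N); auto.
      + exists x. split; auto. intros k Hk HLk. destruct (Nat.eq_dec k (S N)) as [->|Hne].
        * lra.
        * apply Hx; auto. lia. }
  assert (Hx0 : exists x : A, True).
  { destruct (proj2 (HLam 0%nat) (Lam 0%nat + 1) ltac:(lra)) as (x & _). eauto. }
  (* The guard [INR k <= lam] leaves finitely many levels for each [lam], and for fixed [k] it holds
     once [lam] is large. *)
  destruct (choice_fun R A (fun lam x => Lam 0%nat < lam -> P lam x /\
    forall k, INR k <= lam -> Lam k < lam -> Q k x)) as [X HX].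
  { intros lam. destruct (Rlt_dec (Lam 0%nat) lam) as [H|H].
    - destruct (INR_unbounded lam) as [N HN].
      destruct (Hsel lam N H) as (x & HP & Hx). exists x. intros _. split; auto.
      intros k Hk HL. apply Hx; auto. apply INR_le. lra.
    - destruct Hx0 as [x _]. exists x. intros; contradiction. }
  exists (Lam 0%nat), X. split; [apply HLam|]. split.
  - intros lam Hlam. destruct (HX lam Hlam) as [HP HQX]. split; auto. apply HQX; auto.
    simpl. pose proof (proj1 (HLam 0%nat)). lra.
  - intros k. exists (Rmax (Lam 0%nat) (Rmax (Lam k) (INR k))). intros lam Hlam.
    pose proof (Rmax_l (Lam 0%nat) (Rmax (Lam k) (INR k))).
    pose proof (Rmax_r (Lam 0%nat) (Rmax (Lam k) (INR k))).
    pose proof (Rmax_l (Lam k) (INR k)). pose proof (Rmax_r (Lam k) (INR k)).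
    apply HX; lra.
Qed.

Lemma cont_pt_cont_on (f : R -> R) : (forall t, 0 < t < 1 -> continuity_pt f t) -> cont_on O01 f.
Proof.
  intros Hf t Ht eps He.
  destruct (proj1 (continuity_pt_eps f t) (Hf t Ht) eps He) as (del & Hdel & H).
  exists del; split; auto.
Qed.

Lemma limit_solution_is_pos_solution (phi g c d f h u w : R -> R) (lam : R) :
  (forall y, phi (g y) = y) -> continuity g ->
  continuity (fun t => c (clamp t)) -> continuity (fun t => d (clamp t)) ->
  (forall t, 0 <= t <= 1 -> 0 < c t) -> (forall t, 0 <= t <= 1 -> 0 < d t) ->
  continuity (fun x => f (Rmax 0 x)) ->
  (forall t, 0 < t < 1 -> continuity_pt h t) ->
  limit_solution g (fun t => c (clamp t)) (fun t => d (clamp t)) h (fun x => f (Rmax 0 x)) lam u w ->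
  (forall t, 0 < t < 1 -> 0 < u t) ->
  is_pos_solution phi c d h f lam u.
Proof.
  intros Hphig Hg Hc Hd Hcp Hdp Hf Hh (Hu & Hu0 & Hu1 & Hder) Hpos.
  split; auto. split; auto. split; auto. split; auto.
  assert (Hcc : forall t, 0 < c (clamp t) /\ 0 < d (clamp t)).
  { intros t. split; [apply Hcp|apply Hdp]; apply clamp_in. }
  exists (fun t => g (w t / d (clamp t)) / c (clamp t)), (fun t => - (lam * h t * f (Rmax 0 (u t)))).
  split; [|split; [|split; [|split]]].
  - intros t Ht. apply (Hder t Ht).
  - apply cont_pt_cont_on. intros t Ht. destruct (Hcc t).
    apply (continuity_pt_div (fun t => g (w t / d (clamp t))) (fun t => c (clamp t))); auto; [|lra].
    apply (continuity_pt_comp (fun t => w t / d (clamp t)) g); auto.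
    apply (continuity_pt_div w (fun t => d (clamp t))); auto; [|lra].
    eapply derivable_pt_lim_cont, Hder, Ht.
  (* On (0,1) the clamp is the identity and [phi] undoes [g], so [d phi(c u')] coincides with [w]
     near [t] and inherits its derivative. *)
  - intros t Ht. apply is_derive_Reals.
    apply (is_derive_ext_loc w); [|apply is_derive_Reals, Hder, Ht].
    assert (Hm : 0 < Rmin t (1 - t)) by (apply Rmin_glb_lt; lra).
    exists (mkposreal _ Hm). intros s Hs. change (Rabs (s - t) < Rmin t (1 - t)) in Hs.
    apply Rabs_def2 in Hs. pose proof (Rmin_l t (1 - t)). pose proof (Rmin_r t (1 - t)).
    destruct (Hcc s). rewrite clamp_id in * by lra.
    replace (c s * (g (w s / d s) / c s)) with (g (w s / d s)) by (field; lra).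
    rewrite Hphig. assert (E : d s * (w s / d s) = w s) by (field; lra). exact (eq_sym E).
  - apply cont_pt_cont_on. intros t Ht.
    apply (continuity_pt_opp (fun t => lam * h t * f (Rmax 0 (u t)))).
    apply (continuity_pt_mult (fun t => lam * h t) (fun t => f (Rmax 0 (u t)))).
    + apply (continuity_pt_mult (fun _ => lam) h); auto. apply continuity_cst.
    + apply (continuity_pt_comp u (fun x => f (Rmax 0 x))); auto.
      eapply derivable_pt_lim_cont, Hder, Ht.
  - intros t Ht. specialize (Hpos t Ht). rewrite Rmax_right by lra. ring.
Qed.

(** * Translation of the standing hypotheses *)

Section Standing.

Context (phi c d f h : R -> R) (Hst : standing phi c d f h).

Lemma phi_strict (x y : R) : x < y -> phi x < phi y.
Proof. apply Hst. Qed.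

Lemma phi_mono (x y : R) : x <= y -> phi x <= phi y.
Proof. intros [Hxy| ->]; [left; apply phi_strict, Hxy|right; auto]. Qed.

Lemma phi_zero : phi 0 = 0.
Proof. pose proof (proj1 (proj1 Hst) 0) as H. rewrite Ropp_0 in H. lra. Qed.

Lemma f_extended_cont : continuity (fun x => f (Rmax 0 x)).
Proof.
  apply (cont_on_retract Defs.nonneg f (fun x => Rmax 0 x)); [apply Hst| |].
  - intros x. apply continuity_pt_Rmax; [apply continuity_cst|apply continuity_idf].
  - intros x. apply Rmax_l.
Qed.

Lemma phi_inverse :
  exists g, (forall x, g (phi x) = x) /\ (forall y, phi (g y) = y) /\
    (forall x, g (- x) = - g x) /\ (forall x y, x < y -> g x < g y) /\ continuity g.
Proof.
  destruct Hst as ((Hodd & _ & _ & Hsurj) & _).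
  destruct (choice_fun R R (fun y x => phi x = y) Hsurj) as [g Hphig].
  assert (Hinj : forall x y, phi x = phi y -> x = y).
  { intros x y E. destruct (Rtotal_order x y) as [H|[H|H]]; auto;
      apply phi_strict in H; lra. }
  exists g. split; [|split; [|split; [|split]]]; auto.
  - intros x. apply Hinj. rewrite Hodd, !Hphig. auto.
  - intros x y Hxy. destruct (Rlt_dec (g x) (g y)) as [|Hn]; auto.
    pose proof (phi_mono (g y) (g x) ltac:(lra)) as H. rewrite !Hphig in H. lra.
  - apply (cont_on_retract (fun _ => True) g (fun x => x)); auto using continuity_idf.
    apply inverse_continuous with phi; auto. intros; apply phi_strict; auto.
Qed.

Lemma small_regime :
  lim_0plus (fun s => f s / phi s) 0 ->
  forall eps, 0 < eps ->
    exists r, 0 < r /\ forall m x, 0 < m <= r -> x <= m -> f (Rmax 0 x) <= eps * phi m.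
Proof.
  intros Hlim eps He. destruct (Hlim eps He) as (del & Hdel & Hd).
  assert (Hf : forall s, 0 < s < del -> f s <= eps * phi s).
  { intros s Hs. specialize (Hd s Hs). rewrite Rminus_0_r in Hd.
    apply Rabs_def2 in Hd.
    assert (0 < phi s) by (rewrite <- phi_zero; apply phi_strict; lra).
    apply Rle_div_l; [lra|]. lra. }
  exists (del / 2). split; [lra|]. intros m x Hm Hx.
  destruct (Rlt_dec 0 x) as [Hx0|Hx0].
  - rewrite Rmax_right by lra. apply Rle_trans with (eps * phi x); [apply Hf; lra|].
    apply Rmult_le_compat_l; [lra|]. apply phi_mono, Hx.
  (* The limit of [f / phi] says nothing at 0 itself; [f 0] is bounded by continuity through nearby
     points [s] with [0 < s <= m]. *)
  - rewrite Rmax_left by lra. apply Rle_plus_epsilon. intros eta Heta.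
    destruct (proj1 (continuity_pt_eps _ 0) (f_extended_cont 0) eta Heta) as (d' & Hd' & Hc).
    set (s := Rmin (d' / 2) m).
    assert (Hs : 0 < s) by (apply Rmin_glb_lt; lra).
    assert (Hsm : s <= m) by apply Rmin_r. assert (Hsd : s <= d' / 2) by apply Rmin_l.
    specialize (Hc s ltac:(rewrite Rminus_0_r, Rabs_right; lra)).
    rewrite (Rmax_right 0 s), (Rmax_left 0 0) in Hc by lra. apply Rabs_def2 in Hc.
    specialize (Hf s ltac:(lra)).
    assert (eps * phi s <= eps * phi m) by (apply Rmult_le_compat_l; [lra|apply phi_mono, Hsm]).
    lra.
Qed.

Lemma large_regime :
  lim_infty (fun s => f s / phi s) 0 ->
  forall eps, 0 < eps ->
    exists K, 0 < K /\ forall m x, K <= m -> x <= m -> f (Rmax 0 x) <= eps * phi m.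
Proof.
  intros Hlim eps He. destruct (Hlim eps He) as (M0 & HM).
  set (M := Rmax M0 0). assert (HM0 : M0 <= M) by apply Rmax_l.
  assert (HM1 : 0 <= M) by apply Rmax_r.
  destruct (F_bounded (fun x => f (Rmax 0 x)) f_extended_cont) with (m := M) as (C0 & HC0 & HF).
  { intros x Hx. rewrite !Rmax_left by lra. auto. }
  destruct Hst as ((_ & _ & _ & Hsurj) & _).
  (* Beyond [x1] one has [eps * phi m >= C0], which covers the arguments [x <= M], where [f / phi]
     need not be small. *)
  destruct (Hsurj (C0 / eps)) as [x1 Hx1].
  exists (Rmax 1 x1). split; [pose proof (Rmax_l 1 x1); lra|].
  intros m x Hm Hx. pose proof (Rmax_r 1 x1).
  destruct (Rle_dec x M) as [HxM|HxM].
  - apply Rle_trans with C0; [apply HF, HxM|].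
    replace C0 with (eps * (C0 / eps)) by (field; lra). rewrite <- Hx1.
    apply Rmult_le_compat_l; [lra|apply phi_mono; lra].
  - rewrite Rmax_right by lra. specialize (HM x ltac:(lra)). rewrite Rminus_0_r in HM.
    apply Rabs_def2 in HM.
    assert (0 < phi x) by (rewrite <- phi_zero; apply phi_strict; lra).
    apply Rle_trans with (eps * phi x).
    + apply Rle_div_l; [lra|]. lra.
    + apply Rmult_le_compat_l; [lra|apply phi_mono, Hx].
Qed.

Lemma solutions_of_extreme_norm :
  (lim_0plus (fun s => f s / phi s) 0 -> forall R0, 0 < R0 ->
     exists Lam, 0 < Lam /\ forall lam, Lam < lam -> exists u,
       is_pos_solution phi c d h f lam u /\ supnorm u <= R0) /\
  (lim_infty (fun s => f s / phi s) 0 -> forall M, 0 < M ->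
     exists Lam, 0 < Lam /\ forall lam, Lam < lam -> exists u,
       is_pos_solution phi c d h f lam u /\ M <= supnorm u).
Proof.
  destruct phi_inverse as (g & Hgphi & Hphig & Hgodd & Hginc & Hgc).
  pose proof f_extended_cont as Hfc.
  pose proof small_regime as Hsm. pose proof large_regime as Hla.
  destruct Hst as (_ & (psi1 & psi2 & Hpsi1 & Hpsi2 & Hpsi & Hint) & Hc & Hcp & Hd & Hdp &
    Hf & Hf0 & Hfp & Hh & Hh0 & Hhne & _).
  destruct (half_primitives_exist psi1 h Hpsi1 Hh Hh0 Hint)
    as (H & HH & (Jl & ll & HJl) & (Jr & lr & HJr)).
  destruct (cont_on_bounds c Hc Hcp) as (Hcc & cm & cM & Hcm & HcM & Hcb).
  destruct (cont_on_bounds d Hd Hdp) as (Hdc & dm & dM & Hdm & HdM & Hdb).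
  assert (Hp1 : forall y, 0 <= y -> 0 <= inv_pos psi1 y /\ psi1 (inv_pos psi1 y) = y).
  { intros y Hy. unfold inv_pos. apply epsilon_spec. apply Hpsi1, Hy. }
  (* The lower half of condition (A) at [g x] and [inv_pos psi1 y] reads
     [x * y <= phi (g x * inv_pos psi1 y)]; applying [g] yields the claim. *)
  assert (Hgmul : forall x y, 0 <= x -> 0 <= y -> g (x * y) <= g x * inv_pos psi1 y).
  { intros x y Hx Hy. destruct (Hp1 y Hy) as [Hy1 Hy2].
    assert (Hgx : 0 <= g x) by (apply (g_nonneg g Hgodd Hginc), Hx).
    pose proof (proj1 (Hpsi (g x) (inv_pos psi1 y) Hgx Hy1)) as Hle.
    rewrite Hphig, Hy2 in Hle. apply (g_le g Hginc) in Hle. rewrite Hgphi in Hle. exact Hle. }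
  assert (Hcoef : coeffs cm cM dm dM (fun t => c (clamp t)) (fun t => d (clamp t))).
  { split; auto. }
  assert (Hhc : forall t, 0 < t < 1 -> continuity_pt h t) by (intros t Ht; apply cont_on_open; auto).
  assert (HFnn : forall x, 0 <= f (Rmax 0 x)) by (intros x; apply Hf0, Rmax_l).
  assert (HFneg : forall x, x <= 0 -> f (Rmax 0 x) = f (Rmax 0 0)).
  { intros x Hx. rewrite !Rmax_left by lra. auto. }
  assert (HFpos : forall x, 0 < x -> 0 < f (Rmax 0 x)).
  { intros x Hx. rewrite Rmax_right by lra. auto. }
  assert (Hp1n : forall y, 0 <= y -> 0 <= inv_pos psi1 y) by (intros y Hy; apply Hp1, Hy).
  assert (Hpsi2n : forall x, 0 <= x -> 0 <= psi2 x) by apply Hpsi2.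
  assert (Hphimul : forall x y, 0 <= x -> 0 <= y -> phi (x * y) <= phi x * psi2 y)
    by (intros; apply Hpsi; auto).
  split; intros Hlim R0 HR.
  - destruct (small_solutions phi g (inv_pos psi1) (fun t => c (clamp t)) (fun t => d (clamp t)) h
      (fun x => f (Rmax 0 x)) cm cM dm dM Hgphi Hphig Hgodd Hginc Hgc Hp1n Hgmul Hcc Hdc Hcoef Hhc
      Hh0 Hhne Hfc HFnn HFneg HFpos H Jl Jr ll lr HH HJl HJr psi2 Hpsi2n Hphimul R0 (Hsm Hlim) HR)
      as (Lam & HLam & Hsol).
    exists Lam. split; auto. intros lam Hlam.
    destruct (Hsol lam Hlam) as (u & w & Huw & Hub & Hupos). exists u. split.
    + apply (limit_solution_is_pos_solution phi g c d f h u w lam); auto.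
    + destruct Huw as (Huc & Hu0 & Hu1 & _). apply supnorm_le; auto.
      intros t Ht. rewrite Rabs_right; auto.
      destruct (classic (0 < t < 1)) as [Hti|Hti]; [specialize (Hupos t Hti); lra|].
      destruct (Req_dec t 0) as [->|Hne]; [lra|].
      replace t with 1 by lra. lra.
  - destruct (large_solutions phi g (inv_pos psi1) (fun t => c (clamp t)) (fun t => d (clamp t)) h
      (fun x => f (Rmax 0 x)) cm cM dm dM Hgphi Hphig Hgodd Hginc Hgc Hp1n Hgmul Hcc Hdc Hcoef Hhc
      Hh0 Hhne Hfc HFnn HFneg HFpos H Jl Jr ll lr HH HJl HJr psi2 Hpsi2n Hphimul R0 (Hla Hlim) HR)
      as (Lam & HLam & Hsol).
    exists Lam. split; auto. intros lam Hlam.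
    destruct (Hsol lam Hlam) as (u & w & Huw & Hub & Hupos). exists u. split.
    + apply (limit_solution_is_pos_solution phi g c d f h u w lam); auto.
    + apply Rle_trans with (u (1/2)); auto. apply supnorm_ge; [apply Huw|lra].
Qed.

End Standing.

Theorem theorem3p7 (phi c d f h : R -> R) :
  standing phi c d f h ->
  ( (lim_0plus (fun s => f s / phi s) 0 /\
     exists finf, 0 < finf /\ lim_infty (fun s => f s / phi s) finf) ->
    exists (lams : R) (ms : option R),
      0 < lams /\ pos_ext ms /\
      (exists U : R -> R -> R,
         (forall lam, lams < lam ->
            is_pos_solution phi c d h f lam (U lam) /\
            0 < supnorm (U lam) /\ lt_ext (supnorm (U lam)) ms) /\
         lim_infty (fun lam => supnorm (U lam)) 0) /\
      (forall m, ms = Some m -> exists u, is_pos_solution phi c d h f lams u) ) /\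
  ( ((exists f0, 0 < f0 /\ lim_0plus (fun s => f s / phi s) f0) /\
     lim_infty (fun s => f s / phi s) 0) ->
    exists (lams ms : R),
      0 < lams /\ 0 <= ms /\
      (exists U : R -> R -> R,
         (forall lam, lams < lam ->
            is_pos_solution phi c d h f lam (U lam) /\ ms < supnorm (U lam)) /\
         diverges_infty (fun lam => supnorm (U lam))) /\
      (0 < ms -> exists u, is_pos_solution phi c d h f lams u) ).
Proof.
  intros Hst. destruct (solutions_of_extreme_norm phi c d f h Hst) as [Hsmall Hlarge]. split.
  - intros [Hlim _].
    (* The levels [/ INR (S k)] decrease to 0, with the successor avoiding a division by zero at
       [k = 0]; meeting every level eventually is the required convergence of norms. *)
    destruct (threshold_selection (R -> R) (is_pos_solution phi c d h f)
      (fun k u => supnorm u <= / INR (S k))) as (Lam & U & HLam & HU & Hto0).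
    + intros k u Hu. eapply Rle_trans; [exact Hu|]. apply Rinv_le_contravar.
      * apply lt_0_INR. lia.
      * apply le_INR. lia.
    + intros k. apply Hsmall; auto. apply Rinv_0_lt_compat, lt_0_INR. lia.
    + exists Lam, None. split; auto. split; [exact I|]. split; [|discriminate].
      exists U. split.
      * intros lam Hlam. destruct (HU lam Hlam) as [Hsol _]. split; auto. split; [|exact I].
        eapply pos_solution_supnorm_pos, Hsol.
      * intros eps He. destruct (archimed_cor1 eps He) as (N & HN & HN0).
        destruct (Hto0 N) as [M HM]. exists (Rmax M Lam). intros lam Hlam.
        pose proof (Rmax_l M Lam). pose proof (Rmax_r M Lam).
        specialize (HM lam ltac:(lra)).
        assert (Hp : 0 < supnorm (U lam)).
        { eapply pos_solution_supnorm_pos, HU. lra. }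
        rewrite Rminus_0_r, Rabs_right by lra.
        assert (/ INR (S N) <= / INR N); [|lra].
        apply Rinv_le_contravar; [apply lt_0_INR; auto|apply le_INR; lia].
  - intros [_ Hlim].
    (* The levels [INR (S k)] start at 1, because [Hlarge] asks for a positive lower bound. *)
    destruct (threshold_selection (R -> R) (is_pos_solution phi c d h f)
      (fun k u => INR (S k) <= supnorm u)) as (Lam & U & HLam & HU & Htoinf).
    + intros k u Hu. eapply Rle_trans; [|exact Hu]. apply le_INR. lia.
    + intros k. apply Hlarge; auto. apply lt_0_INR. lia.
    + exists Lam, 0. split; auto. split; [lra|]. split; [|lra].
      exists U. split.
      * intros lam Hlam. destruct (HU lam Hlam) as [Hsol _]. split; auto.
        eapply pos_solution_supnorm_pos, Hsol.
      * intros K. destruct (INR_unbounded K) as [N HN].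
        destruct (Htoinf N) as [M HM]. exists M. intros lam Hlam.
        specialize (HM lam Hlam). rewrite S_INR in HM. lra.
Qed.
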